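(* Let $A\in\mathbb{R}^{m\times n}$ and $\tau>0$. Then the random index set $S$ returned by the algorithm ARP-tol (with inputs $A$, a block size $b$, and tolerance $\tau$), together with the matrix $V$ constructed by that algorithm, satisfies $$\mathbb{E}\,\|A-A(:,S)\,V(S,:)^{-T}V^T\|_F^2\le \tau .$$
   Context: Notation: for a matrix $M$ and index set $J$, $M(:,J)$ and $M(J,:)$ are the submatrices of the columns, resp. rows, indexed by $J$; $M(j,a:b)$ is the part of row $j$ in columns $a,\dots,b$; $M^{-T}=(M^{-1})^T$; $\|\cdot\|_F$ is the Frobenius norm; $\mathrm{orth}(M)$ is a matrix whose columns form an orthonormal basis of the column space of $M$. Computations are in exact arithmetic. Algorithm ARP-rank (adaptive randomized pivoting). Input: $V\in\mathbb{R}^{n\times k}$ with orthonormal columns. Set $S=\emptyset$, $V^{(0)}=V$. For $i=1,\dots,k$: sample a random index $s_i\in\{1,\dots,n\}$ with (conditional) probability $\mathbb{P}(s_i=j)=p_j=\|V^{(i-1)}(j,i:k)\|_2^2/(k-i+1)$, append $s_i$ to $S$, and set $V^{(i)}=V^{(i-1)}H_i$, where $H_i$ is an orthogonal $k\times k$ matrix (Householder reflector acting only on columns $i,\dots,k$) such that the entries $V^{(i)}(s_i,i+1:k)$ are zero. Output: $S=\{s_1,\dots,s_k\}$ (and $V^{(k)}$). Algorithm ARP-tol (adaptive randomized pivoting with fixed precision). Input: $A\in\mathbb{R}^{m\times n}$, block size $b$ (a positive integer), tolerance $\tau$. Initialize $V$ and $B$ as empty matrices, $k=0$, $E=\|A\|_F^2$.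 While $E>\tau/(k+1)$, do: (1) $k\leftarrow k+b$; (2) draw a random matrix $\Omega\in\mathbb{R}^{m\times b}$ with i.i.d. standard Gaussian entries (independent of the past); (3) $V_i\leftarrow \mathrm{orth}(A^T\Omega-V(B\Omega))$; (4) $V_i\leftarrow\mathrm{orth}(V_i-V(V^TV_i))$; (5) $B_i\leftarrow V_i^TA^T$; (6) $V\leftarrow[V,V_i]$ and $B\leftarrow\begin{bmatrix} B \\ {B_i} \end{bmatrix}$ (so $V$ has orthonormal columns and $B=V^TA^T$); (7) $E\leftarrow E-\|B_i\|_F^2$ (so $E=\|A-AVV^T\|_F^2$). After the loop, apply ARP-rank to $V$ to obtain $S$; output $k$ (the number of columns of $V$) and $S$. The expectation is over all the randomness in the algorithm. *)

(* Defs.v *)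
From HB Require Import structures.
From mathcomp Require Import all_boot all_order all_algebra.
From mathcomp Require Import all_classical all_reals all_analysis.

Set Implicit Arguments.
Unset Strict Implicit.
Unset Printing Implicit Defensive.
Import Order.TTheory GRing.Theory Num.Theory.
Import numFieldNormedType.Exports.
Local Open Scope classical_set_scope.
Local Open Scope ring_scope.

Definition frob2 (R : realType) p q (M : 'M[R]_(p, q)) : R :=
  \sum_i \sum_j M i j ^+ 2.

(** ** The two linear-algebra subroutines

    Both are only specified up to a choice (of a basis, of a sign), so the
    algorithm takes arbitrary implementations as parameters. *)

(* An orthonormal basis of the column space of [M] has exactly [\rank M]
   vectors; it may be empty. Column spaces are row spaces of transposes. *)
Definition orth_fun (R : realType) :=
  forall n p (M : 'M[R]_(n, p)), 'M[R]_(n, \rank M).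

Definition orth_spec (R : realType) (orth : orth_fun R) :=
  forall n p (M : 'M[R]_(n, p)),
    (orth n p M)^T *m orth n p M = 1%:M /\
    ((orth n p M)^T :=: M^T)%MS.

(* The Householder reflector I - 2 u^T u / (u u^T); as [0^-1 = 0], it is the
   identity for [u = 0], the usual convention when there is nothing to zero. *)
Definition reflector (R : realType) k (u : 'rV[R]_k) : 'M[R]_k :=
  1%:M - (2 / (u *m u^T) 0 0) *: (u^T *m u).

(* [refl k i x] is the matrix built from the pivot row [x] in the step that has
   [i] predecessors (steps and columns are numbered from 0). *)
Definition reflector_fun (R : realType) :=
  forall k : nat, nat -> 'rV[R]_k -> 'M[R]_k.

Definition reflector_spec (R : realType) (refl : reflector_fun R) :=
  forall (k i : nat) (x : 'rV[R]_k), (i < k)%N ->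
    (exists u : 'rV[R]_k,
       (forall j : 'I_k, (j < i)%N -> u 0 j = 0) /\ refl k i x = reflector u) /\
    (forall j : 'I_k, (i < j)%N -> (x *m refl k i x) 0 j = 0).

(** ** Adaptive randomized pivoting (ARP-rank) *)

(* The matrix obtained from [V] after processing the pivots s_0, ..., s_(i-1). *)
Fixpoint arp_iter (R : realType) (refl : reflector_fun R) n k
    (V : 'M[R]_(n, k)) (s : nat -> 'I_n) (i : nat) : 'M[R]_(n, k) :=
  if i is i'.+1 then
    let W := arp_iter refl V s i' in W *m refl k i' (row (s i') W)
  else V.

(* The probability of choosing [j] as pivot s_i, given s_0, ..., s_(i-1). *)
Definition pivot_prob (R : realType) (refl : reflector_fun R) n k
    (V : 'M[R]_(n, k)) (s : nat -> 'I_n) (i : nat) (j : 'I_n) : R :=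
  (\sum_(l < k | (i <= l)%N) arp_iter refl V s i j l ^+ 2) / (k - i)%:R.

(** ** The fixed-precision loop of ARP-tol *)

(* [st_k] is the loop counter, increased by the block size at every pass;
   [st_cols], the number of columns of V, is smaller when a block is rank
   deficient. *)
Record state (R : realType) (m n : nat) := State {
  st_cols : nat;
  st_V : 'M[R]_(n, st_cols);
  st_B : 'M[R]_(st_cols, m);
  st_k : nat;
  st_E : R }.

Definition init_state (R : realType) m n (A : 'M[R]_(m, n)) : state R m n :=
  @State R m n 0 0 0 0 (frob2 A).

Definition loop_body (R : realType) (orth : orth_fun R) m n b
    (A : 'M[R]_(m, n)) (Om : 'M[R]_(m, b)) (st : state R m n) : state R m n :=
  let V := st_V st in
  let B := st_B st in
  let V1 := orth _ _ (A^T *m Om - V *m (B *m Om)) in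
  let V2 := orth _ _ (V1 - V *m (V^T *m V1)) in
  let B2 := V2^T *m A^T in
  State (row_mx V V2) (col_mx B B2) (st_k st + b) (st_E st - frob2 B2).

Definition halted (R : realType) m n (tau : R) (st : state R m n) : bool :=
  st_E st <= tau / (st_k st).+1%:R.

(* The state after [t] passes, whether or not the loop test failed before. *)
Fixpoint loop_state (R : realType) (orth : orth_fun R) m n b
    (A : 'M[R]_(m, n)) (Om : nat -> 'M[R]_(m, b)) (t : nat) : state R m n :=
  if t is t'.+1 then loop_body orth A (Om t') (loop_state orth A Om t')
  else init_state A.

(* The number of passes actually performed; [None] if the loop runs forever. *)
Definition passes (R : realType) (orth : orth_fun R) m n b
    (A : 'M[R]_(m, n)) (tau : R) (Om : nat -> 'M[R]_(m, b)) : option nat :=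
  if pselect (exists t, halted tau (loop_state orth A Om t)) is left h
  then Some (ex_minn h) else None.

(** ** The error of the returned approximation *)

(* The matrix A - A(:,S) V(S,:)^{-T} V^T, for the pivots S = (s_0, ..., s_(k-1)),
   as many as columns of [V]. *)
Definition residual (R : realType) m n k (A : 'M[R]_(m, n))
    (V : 'M[R]_(n, k)) (s : nat -> 'I_n) : 'M[R]_(m, n) :=
  let S := fun i : 'I_k => s i in
  A - colsub S A *m (invmx (rowsub S V))^T *m V^T.

(* The error counts as infinite if the algorithm does not return or if V(S,:)
   is singular, so that a bound on its expectation cannot owe anything to the
   value chosen where the informal expression is undefined. *)
Definition arp_error (R : realType) (orth : orth_fun R) m n b
    (A : 'M[R]_(m, n)) (tau : R) (Om : nat -> 'M[R]_(m, b)) (s : nat -> 'I_n) :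
    \bar R :=
  if passes orth A tau Om is Some t then
    let st := loop_state orth A Om t in
    if rowsub (fun i : 'I_(st_cols st) => s i) (st_V st) \in unitmx
    then (frob2 (residual A (st_V st) s))%:E else +oo%E
  else +oo%E.

(** ** Randomness *)

(* The Gaussian entries: [X t i j] is entry (i, j) of the matrix drawn in pass
   number [t] (from 0). *)
Definition gauss_mx (R : realType) d (T : measurableType d)
    (P : probability T R) m b (X : nat -> 'I_m -> 'I_b -> {RV P >-> R})
    (w : T) (t : nat) : 'M[R]_(m, b) :=
  \matrix_(i, j) X t i j w.

Definition mutually_independent (R : realType) d (T : measurableType d)
    (P : probability T R) (I : eqType) (X : I -> {RV P >-> R}) :=
  forall (J : seq I) (Y : I -> set R), uniq J ->
    (forall a, measurable (Y a)) ->
    P (\bigcap_(a in [set` J]) (X a @^-1` Y a)) =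
    (\prod_(a <- J) P (X a @^-1` Y a))%E.

Definition iid_std_normal (R : realType) d (T : measurableType d)
    (P : probability T R) (I : eqType) (X : I -> {RV P >-> R}) :=
  mutually_independent X /\
  forall a (Y : set R), measurable Y ->
    distribution P (X a) Y = normal_prob 0 1 Y.

(* The events determined by the first [t] Gaussian matrices and the first [i]
   pivots. *)
Definition past (R : realType) d (T : measurableType d)
    (P : probability T R) m b n (X : nat -> 'I_m -> 'I_b -> {RV P >-> R})
    (s : nat -> T -> 'I_n) (t i : nat) : set (set T) :=
  <<s [set G | (exists u a c (Y : set R),
                  [/\ (u < t)%N, measurable Y & G = X u a c @^-1` Y]) \/
               (exists l j, (l < i)%N /\ G = s l @^-1` [set j])] >>.

(* On the event [D] that the loop performs exactly [t] passes and that pivot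
   s_i exists, the conditional probability of s_i = j given the past is
   [pivot_prob]; conditional probability is taken in Kolmogorov's sense.
   Nothing is required of s_i where the algorithm does not draw it. *)
Definition pivots_sampled (R : realType) (orth : orth_fun R)
    (refl : reflector_fun R) m n b (A : 'M[R]_(m, n)) (tau : R)
    d (T : measurableType d) (P : probability T R)
    (X : nat -> 'I_m -> 'I_b -> {RV P >-> R}) (s : nat -> T -> 'I_n) :=
  (forall i j, measurable (s i @^-1` [set j])) /\
  forall t i (j : 'I_n) (G : set T), past X s t i G ->
    let st w := loop_state orth A (gauss_mx X w) t in
    let D := [set w | passes orth A tau (gauss_mx X w) = Some t /\
                      (i < st_cols (st w))%N] in
    P (G `&` D `&` s i @^-1` [set j]) =
    (\int[P]_(w in G `&` D)
       (pivot_prob refl (st_V (st w)) (s^~ w) i j)%:E)%E.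

(* Main.v *)
(* The pivot probabilities and the error depend on V only through the orthogonal
   projection Pi = V V^T, and Pi is a measurable function of the Gaussian
   matrices (Gram-Schmidt), whatever bases [orth] returns.

   Let S_i be the first i pivots. The reflectors keep the pivot rows lower
   triangular, so det Pi(S_i, S_i) is the product of (k - l) p_l over l < i, and
   by induction on i the law of S_i given Pi has density det Pi(S_i, S_i) divided
   by k (k-1) ... (k-i+1). For i = k this is volume sampling. By Cramer's rule and
   the Cauchy-Binet formula the mean of |A - A(:,S) V(S,:)^{-T} V^T|^2 under it is at
   most (k + 1) |A - A V V^T|^2, and the halting test bounds this by tau, as V
   has at most as many columns as the loop counter says.

   The loop halts almost surely: while A - A Pi <> 0, a pass that adds no column
   to V would force a Gaussian entry to equal a function of the other ones. *)

Require Import Defs.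
From mathcomp Require Import all_boot all_order all_algebra.
From mathcomp Require Import perm.
From mathcomp Require Import all_classical all_reals all_analysis.
From mathcomp Require Import measurable_realfun.
From mathcomp Require Import ring.
Set Implicit Arguments.
Unset Strict Implicit.
Unset Printing Implicit Defensive.
Import Order.TTheory GRing.Theory Num.Theory.
Local Open Scope ring_scope.

(** * Cauchy-Binet and the mean residual under volume sampling *)

Section Frobenius.
Variable R : realType.

Lemma frob2_trace p q (M : 'M[R]_(p, q)) : frob2 M = \tr (M *m M^T).
Proof.
by apply: eq_bigr => i _; rewrite mxE; apply: eq_bigr => j _; rewrite mxE expr2.
Qed.

Lemma frob2_ge0 p q (M : 'M[R]_(p, q)) : 0 <= frob2 M.
Proof. by do 2![apply: sumr_ge0 => ? _]; exact: sqr_ge0. Qed.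

Lemma frob2_eq0 p q (M : 'M[R]_(p, q)) : frob2 M = 0 -> M = 0.
Proof.
have ge0 (r : 'rV[R]_q) : 0 <= \sum_j r 0 j ^+ 2.
  by apply: sumr_ge0 => j _; exact: sqr_ge0.
move=> M0; apply/matrixP => i j; rewrite mxE; apply/eqP; rewrite -sqrf_eq0.
have Mi : \sum_j M i j ^+ 2 = 0.
  apply: (psumr_eq0P _ M0) => // l _.
  by have := ge0 (row l M); under eq_bigr do rewrite mxE.
by apply/eqP; apply: (psumr_eq0P _ Mi) => // l _; exact: sqr_ge0.
Qed.

End Frobenius.

Section CauchyBinet.
Variable R : comPzRingType.

(** Cauchy-Binet over ordered row choices, the form in which pivots are drawn: each $k$-subset
    occurs $k!$ times, and a repeated index gives determinant zero. The factor $k!$ is realized as a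
    sum over row permutations of $M^T M$; both sides then have the same Leibniz expansion. *)
Lemma sum_det_rowsub_sqr n k (M : 'M[R]_(n, k)) :
  \sum_(J : {ffun 'I_k -> 'I_n}) \det (rowsub J M) ^+ 2 =
  (k`!)%:R * \det (M^T *m M).
Proof.
transitivity (\sum_(s : 'S_k) (-1) ^+ s * \det (row_perm s (M^T *m M))); last first.
  rewrite -card_Sn -sum1_card natr_sum mulr_suml; apply: eq_big => [s|s _].
    by rewrite inE.
  rewrite row_permE det_mulmx det_perm mulrA -expr2 sqrr_sign.
  by rewrite mul1r.
under [RHS]eq_bigr do rewrite mulr_sumr.
under [LHS]eq_bigr => J _ do rewrite expr2 {1}/determinant mulr_suml.
rewrite exchange_big /=; apply: eq_bigr => s _.
under [LHS]eq_bigr => J _ do rewrite /determinant mulr_sumr.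
rewrite exchange_big /=; apply: eq_bigr => r _.
under [in RHS]eq_bigr => i _ do rewrite !mxE.
rewrite (bigA_distr_bigA (fun i j => M^T (s i) j * M j (r i))) /= !mulr_sumr.
apply: eq_bigr => J _; rewrite big_split /= -mulrA; congr (_ * _).
rewrite mulrCA; congr (_ * (_ * _)); apply: eq_bigr => i _; by rewrite !mxE.
Qed.

Definition replace_col n k (l : 'I_k) (x : 'I_n -> R) (M : 'M[R]_(n, k)) :=
  \matrix_(i, j) if j == l then x i else M i j.

(** Cramer's rule in adjugate form: expanding along column [l], the cofactors do not see the
    replaced entries. *)
Lemma adj_replace_col k (B : 'M[R]_k) (x : 'cV[R]_k) l :
  (\adj B *m x) l 0 = \det (replace_col l (x^~ 0) B).
Proof.
rewrite (expand_det_col _ l) mxE; apply: eq_bigr => i _.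
rewrite !mxE eqxx mulrC; congr (_ * (_ * \det _)); apply/matrixP => a c.
by rewrite !mxE [lift l c == l]eq_sym (negPf (neq_lift l c)).
Qed.

End CauchyBinet.

Section PivotExpectation.
Variables (R : realType) (n k : nat) (V : 'M[R]_(n, k)).
Hypothesis V_orth : V^T *m V = 1%:M.

(** As [x] is orthogonal to the columns of [V], the Gram matrix after the replacement is diagonal,
    with $|x|^2$ at place [l] and 1 elsewhere; Cauchy-Binet concludes. *)
Lemma sum_det_replace_col (x : 'cV[R]_n) (l : 'I_k) : V^T *m x = 0 ->
  \sum_(J : {ffun 'I_k -> 'I_n}) \det (rowsub J (replace_col l (x^~ 0) V)) ^+ 2
  = (k`!)%:R * (x^T *m x) 0 0.
Proof.
move=> Vx; rewrite sum_det_rowsub_sqr; congr (_ * _).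
set W := replace_col _ _ _.
have -> : W^T *m W = diag_mx (\row_j if j == l then (x^T *m x) 0 0 else 1).
  have Vx0 j : \sum_i V i j * x i 0 = 0.
    have /matrixP/(_ j 0) := Vx; rewrite !mxE; apply: etrans.
    by apply: eq_bigr => i _; rewrite mxE.
  apply/matrixP => a c; rewrite !mxE.
  transitivity (\sum_i (if a == l then x i 0 else V i a) *
                       (if c == l then x i 0 else V i c)).
    by apply: eq_bigr => i _; rewrite !mxE.
  case: (eqVneq a l) => [->|al]; case: (eqVneq c l) => [cl|cl].
  - by rewrite mulrb /=; apply: eq_bigr => i _; rewrite mxE.
  - rewrite mulrb -[RHS](Vx0 c).
    by apply: eq_bigr => i _; rewrite mulrC.
  - by rewrite cl (negPf al) Vx0.
  - have /matrixP/(_ a c) := V_orth; rewrite !mxE; apply: etrans.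
    by apply: eq_bigr => i _; rewrite mxE.
rewrite det_diag (bigD1 l) //= mxE eqxx big1 ?mulr1 // => j jl.
by rewrite mxE (negPf jl).
Qed.

(** Pythagoras: the rows of [N] are orthogonal to the range of [V], those of $Y V^T$ lie in it, and
    $V^T$ preserves the norm of [Y]. *)
Lemma frob2_sub_orthogonal m (N : 'M[R]_(m, n)) (Y : 'M[R]_(m, k)) :
  N *m V = 0 -> frob2 (N - Y *m V^T) = frob2 N + frob2 Y.
Proof.
move=> NV; have VN : V^T *m N^T = 0 by rewrite -trmx_mul NV trmx0.
rewrite !frob2_trace -linearD /=; congr (\tr _).
rewrite linearB /= trmx_mul trmxK mulmxBr !mulmxBl.
rewrite -[Y *m V^T *m N^T]mulmxA VN mulmx0 subr0 [N *m (V *m _)]mulmxA NV mul0mx.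
by rewrite sub0r opprK -mulmxA [V^T *m (V *m _)]mulmxA V_orth mul1mx.
Qed.

(** Interpolation at [J] reproduces $A V V^T$ exactly, so only $N = A - A V V^T$ leaves a residual,
    namely $N - N(:,J) V(J,:)^{-T} V^T$, whose two terms are orthogonal. *)
Lemma frob2_residual m (A : 'M[R]_(m, n)) (J : 'I_k -> 'I_n) :
  rowsub J V \in unitmx ->
  frob2 (A - colsub J A *m (invmx (rowsub J V))^T *m V^T) =
  frob2 (A - A *m V *m V^T) +
  frob2 (colsub J (A - A *m V *m V^T) *m (invmx (rowsub J V))^T).
Proof.
move=> uV; set N := A - A *m V *m V^T; set Y := colsub J N *m _.
rewrite -frob2_sub_orthogonal; last first.
  by rewrite mulmxBl -!mulmxA V_orth mulmx1 subrr.
congr (frob2 _).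
have -> : colsub J A = colsub J N + A *m V *m (rowsub J V)^T.
  apply/matrixP => i j; rewrite !mxE -[LHS]addr0 -addrA; congr (_ + _).
  rewrite addrC; apply/esym/eqP; rewrite subr_eq0; apply/eqP.
  by apply: eq_bigr => c _; rewrite !mxE.
rewrite mulmxDl -(mulmxA (A *m V)) -trmx_mul mulVmx // trmx1 mulmx1.
by rewrite mulmxDl opprD /N addrA addrAC.
Qed.

(** The weight $\det V(J,:)^2$ turns the squared entries of $N(:,J) V(J,:)^{-T}$ into squared Cramer
    determinants. Each row of $N$ and each of the $k$ columns contributes $k!$ times the squared row
    norm, and the term $|N|^2$ adds one more. It is an inequality because a singular [J] has weight
    zero on the left, while its Cramer determinants may be nonzero. *)
Lemma sum_det_residual m (A : 'M[R]_(m, n)) :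
  \sum_(J : {ffun 'I_k -> 'I_n}) \det (rowsub J V) ^+ 2 *
     frob2 (A - colsub J A *m (invmx (rowsub J V))^T *m V^T) <=
  (k`!)%:R * k.+1%:R * frob2 (A - A *m V *m V^T).
Proof.
set N := A - A *m V *m V^T.
have VN : V^T *m N^T = 0.
  by rewrite -trmx_mul mulmxBl -!mulmxA V_orth mulmx1 subrr trmx0.
pose S (J : {ffun 'I_k -> 'I_n}) :=
  \sum_i \sum_l \det (rowsub J (replace_col l ((row i N)^T^~ 0) V)) ^+ 2.
apply: (@le_trans _ _ (\sum_(J : {ffun 'I_k -> 'I_n})
   (\det (rowsub J V) ^+ 2 * frob2 N + S J))).
  apply: ler_sum => J _; have [uV|] := boolP (rowsub J V \in unitmx); last first.
    rewrite unitmxE unitfE negbK => /eqP ->.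
    by rewrite expr0n !mul0r add0r; do 2![apply: sumr_ge0 => ? _]; exact: sqr_ge0.
  rewrite frob2_residual // mulrDr lerD2l le_eqVlt; apply/orP; left; apply/eqP.
  rewrite mulr_sumr; apply: eq_bigr => i _.
  rewrite mulr_sumr; apply: eq_bigr => l _; rewrite -exprMn; congr (_ ^+ 2).
  have := adj_replace_col (rowsub J V) (\col_a N i (J a)) l.
  have -> : replace_col l ((\col_a N i (J a))^~ 0) (rowsub J V) =
            rowsub J (replace_col l ((row i N)^T^~ 0) V).
    by apply/matrixP => a c; rewrite !mxE; case: ifP.
  move=> <-; rewrite -[\adj _]/(\adj _).
  rewrite /invmx uV linearZ /= -scalemxAr mxE mulrA divff ?mul1r; last first.
    by rewrite -unitfE -unitmxE.
  by rewrite !mxE; apply: eq_bigr => a _; rewrite !mxE mulrC.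
rewrite big_split /= -mulr_suml sum_det_rowsub_sqr V_orth det1 mulr1.
suff -> : \sum_J S J = k`!%:R * k%:R * frob2 N.
  by rewrite -natr1 mulrDr mulr1 mulrDl addrC.
rewrite /S exchange_big mulr_sumr; apply: eq_bigr => i _.
rewrite exchange_big -mulrA [k%:R * _]mulrC mulrA mulr_natr.
rewrite -[X in _ *+ X](card_ord k).
rewrite -sumr_const. apply: eq_bigr => l _.
rewrite sum_det_replace_col; last by rewrite tr_row colE mulmxA VN mul0mx.
by rewrite mxE; congr (_ * _); apply: eq_bigr => j _; rewrite !mxE expr2.
Qed.

End PivotExpectation.

(** * Orthogonal projections, reflectors and pivots *)

Section OrthogonalProjections.
Variable R : realType.

Definition is_oproj n (P : 'M[R]_n) := P^T = P /\ P *m P = P.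

(** Inclusion of ranges gives $P = PQ$ and $Q = QP$; transposing the first yields $P = QP = Q$. This
    makes the projection independent of the basis chosen by [orth]. *)
Lemma oproj_inj n (P Q : 'M[R]_n) :
  is_oproj P -> is_oproj Q -> (P :=: Q)%MS -> P = Q.
Proof.
move=> [Pt PP] [Qt QQ] PQ.
have /submxP[D defP] : (P <= Q)%MS by rewrite PQ.
have /submxP[D' defQ] : (Q <= P)%MS by rewrite PQ.
have PQP : P *m Q = P by rewrite defP -mulmxA QQ.
have QPQ : Q *m P = Q by rewrite defQ -mulmxA PP.
by rewrite -Pt -PQP trmx_mul Pt Qt.
Qed.

Lemma oproj_mul_tr n k (V : 'M[R]_(n, k)) :
  V^T *m V = 1%:M -> is_oproj (V *m V^T) /\ (V *m V^T :=: V^T)%MS.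
Proof.
move=> VV; split; first split.
- by rewrite trmx_mul trmxK.
- by rewrite mulmxA -(mulmxA V) VV mulmx1.
apply/eqmxP/andP; split; first exact: submxMl.
apply/submxP; exists V^T.
by rewrite mulmxA VV mul1mx.
Qed.

(* One Gram-Schmidt step; [0^-1 = 0] leaves [P] unchanged when [c] already lies
   in the range of [P]. *)
Definition gram_schmidt n (P : 'M[R]_n) (c : 'cV[R]_n) : 'M[R]_n :=
  let r := c - P *m c in P + ((r^T *m r) 0 0)^-1 *: (r *m r^T).

Lemma tr_mul_eq0 n (r : 'cV[R]_n) : (r^T *m r) 0 0 = 0 -> r = 0.
Proof.
move=> r0; apply: frob2_eq0; rewrite frob2_trace mxtrace_mulC.
by rewrite /mxtrace big_ord1.
Qed.

(** The remainder $r = c - Pc$ is orthogonal to the range of [P], so for nonzero [r] the projection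
    onto its line can be added; the range grows by [c] because $c = r + Pc$. *)
Lemma gram_schmidtP n (P : 'M[R]_n) (c : 'cV[R]_n) : is_oproj P ->
  is_oproj (gram_schmidt P c) /\ (gram_schmidt P c :=: P + c^T)%MS.
Proof.
move=> [Pt PP]; rewrite /gram_schmidt; set r := c - P *m c.
have [a0|a0] := eqVneq ((r^T *m r) 0 0) 0.
  rewrite a0 invr0 scale0r addr0; split=> //.
  have /eqP := tr_mul_eq0 a0; rewrite subr_eq0 => /eqP ->.
  apply/eqmx_sym/addsmx_idPl.
  by rewrite trmx_mul Pt submxMl.
set a := (r^T *m r) 0 0 in a0 *.
have Pr : P *m r = 0 by rewrite /r mulmxBr mulmxA PP subrr.
have rP : r^T *m P = 0 by rewrite -Pt -trmx_mul Pr trmx0.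
have rr : r^T *m r = a%:M by rewrite [LHS]mx11_scalar.
set Q := P + _.
have PQ : P *m Q = P by rewrite mulmxDr PP -scalemxAr mulmxA Pr mul0mx scaler0 addr0.
have rQ : r^T *m Q = r^T.
  rewrite mulmxDr rP add0r -scalemxAr mulmxA rr mul_scalar_mx scalerA.
  by rewrite mulVf // scale1r.
have cE : c = r + P *m c by rewrite subrK.
clearbody r; split; first split.
- by rewrite linearD linearZ /= Pt trmx_mul trmxK.
- by rewrite {1}/Q mulmxDl PQ -scalemxAl -mulmxA rQ.
apply/eqmxP/andP; split.
  rewrite addmx_sub ?addsmxSl // scalemx_sub // (submx_trans (submxMl _ _)) //.
  have -> : r^T = c^T - c^T *m P by rewrite {1}cE linearD /= trmx_mul Pt addrK.
  rewrite addmx_sub ?addsmxSr // eqmx_opp.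
  exact: submx_trans (submxMl _ _) (addsmxSl _ _).
rewrite addsmx_sub; apply/andP; split; first by apply/submxP; exists P.
rewrite cE linearD /= trmx_mul Pt addmx_sub //.
  by apply/submxP; exists r^T.
by rewrite -PQ mulmxA submxMl.
Qed.

Fixpoint add_columns n p : 'M[R]_n -> 'M[R]_(n, p) -> 'M[R]_n :=
  if p is p'.+1 then fun P (M : 'M[R]_(n, 1 + p')) =>
    add_columns (gram_schmidt P (lsubmx M)) (rsubmx M)
  else fun P _ => P.

Lemma add_columnsP n p (P : 'M[R]_n) (M : 'M[R]_(n, p)) : is_oproj P ->
  is_oproj (add_columns P M) /\ (add_columns P M :=: P + M^T)%MS.
Proof.
elim: p => [|p IHp] in P M *.
  by move=> oP; split=> //; rewrite [M]thinmx0 trmx0; exact/eqmx_sym/addsmx0.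
move=> oP; have [oQ defQ] := gram_schmidtP (@lsubmx _ n 1 p M) oP.
have [oR defR] := IHp _ (@rsubmx _ n 1 p M) oQ; split=> //=.
apply: (eqmx_trans defR); apply: (eqmx_trans (adds_eqmx defQ (eqmx_refl _))).
have -> : M^T = col_mx (@lsubmx _ n 1 p M)^T (@rsubmx _ n 1 p M)^T.
  by rewrite -tr_row_mx hsubmxK.
rewrite -addsmxA.
exact: adds_eqmx (eqmx_refl _) (addsmxE _ _).
Qed.

End OrthogonalProjections.

(** * Householder reflectors *)

Section Reflectors.
Variables (R : realType) (k : nat).

(** The reflector is symmetric, so it suffices that it is an involution, which follows from $(u^T
    u)^2 = (u u^T) u^T u$. *)
Lemma reflector_orthogonal (u : 'rV[R]_k) :
  reflector u *m (reflector u)^T = 1%:M.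
Proof.
have -> : (reflector u)^T = reflector u.
  by rewrite /reflector linearB linearZ /= trmx1 trmx_mul trmxK.
rewrite /reflector; set c := (u *m u^T) 0 0.
have [->|c0] := eqVneq c 0; first by rewrite invr0 mulr0 scale0r subr0 mulmx1.
rewrite mulmxBl mul1mx mulmxBr mulmx1 -scalemxAl -scalemxAr scalerA.
have -> : u^T *m u *m (u^T *m u) = c *: (u^T *m u).
  rewrite mulmxA -(mulmxA u^T) [u *m u^T]mx11_scalar -/c.
  by rewrite -mulmxA mul_scalar_mx scalemxAr.
rewrite scalerA -mulrA divfK // mulr_natr mulr2n scalerDl.
by rewrite opprB addrK subrK.
Qed.

Variables (i : nat) (u : 'rV[R]_k).
Hypothesis u_tail : forall j : 'I_k, (j < i)%N -> u 0 j = 0.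

Lemma mul_reflectorE (x : 'rV[R]_k) :
  x *m reflector u = x - (2 / (u *m u^T) 0 0 * (x *m u^T) 0 0) *: u.
Proof.
rewrite mulmxBr mulmx1 -scalemxAr mulmxA [in LHS](mx11_scalar (x *m u^T)).
by rewrite mul_scalar_mx scalerA.
Qed.

Lemma mul_reflector_head (x : 'rV[R]_k) (j : 'I_k) :
  (j < i)%N -> (x *m reflector u) 0 j = x 0 j.
Proof. by move=> ji; rewrite mul_reflectorE !mxE u_tail // mulr0 subr0. Qed.

Lemma mul_reflector_id (x : 'rV[R]_k) :
  (forall j : 'I_k, (i <= j)%N -> x 0 j = 0) -> x *m reflector u = x.
Proof.
move=> x0; rewrite mul_reflectorE.
suff -> : x *m u^T = 0 by rewrite [X in _ * X]mxE mulr0 scale0r subr0.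
apply/rowP => j; rewrite !mxE big1 // => l _; rewrite mxE.
have [li|il] := ltnP l i; last by rewrite x0 ?mul0r.
by rewrite [j]ord1 u_tail ?mulr0.
Qed.

End Reflectors.

(** * Pivot rows and principal minors of $V V^T$ *)

Section Pivots.
Variables (R : realType) (refl : reflector_fun R).
Hypothesis reflP : reflector_spec refl.
Variables (n k : nat) (V : 'M[R]_(n, k)) (s : nat -> 'I_n).
Local Notation W := (arp_iter refl V s).

Lemma arp_iter_gram i : (i <= k)%N -> W i *m (W i)^T = V *m V^T.
Proof.
elim: i => // i IHi ik; rewrite -IHi 1?ltnW //=.
have [[u [_ ->]] _] := reflP (row (s i) (W i)) ik.
by rewrite trmx_mul mulmxA -(mulmxA (W i)) reflector_orthogonal mulmx1.
Qed.

(** Step [l] clears row [s l] to the right of column [l]; the vector of a later reflector vanishes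
    on the columns before its own step, so that reflector fixes this row. *)
Lemma arp_iter_trig i (l : nat) (j : 'I_k) :
  (i <= k)%N -> (l < i)%N -> (l < j)%N -> W i (s l) j = 0.
Proof.
elim: i j => // i IHi j ik; rewrite ltnS => li lj.
have [[u [u0 defH]] pivot0] := reflP (row (s i) (W i)) ik.
have rowE : W i.+1 (s l) j = (row (s l) (W i) *m refl i (row (s i) (W i))) 0 j.
  by rewrite -row_mul [RHS]mxE.
rewrite rowE; have [li0|li0] := eqVneq l i; first by rewrite li0 pivot0 -?li0.
have {}li : (l < i)%N by rewrite ltn_neqAle li0.
rewrite defH (mul_reflector_id u0) => [|c ic]; rewrite mxE IHi ?(ltnW ik) //.
exact: leq_trans ic.
Qed.

Lemma arp_iter_pivot_row i l :
  (i <= k)%N -> (l < i)%N -> row (s l) (W i) = row (s l) (W l.+1).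
Proof.
elim: i => // i IHi ik; rewrite ltnS leq_eqVlt => /predU1P[->//|li].
rewrite -IHi ?(ltnW ik) //=. rewrite row_mul.
have [[u [u0 ->]] _] := reflP (row (s i) (W i)) ik.
rewrite (mul_reflector_id u0) // => c ic.
by rewrite mxE arp_iter_trig ?(ltnW ik) // (leq_trans li).
Qed.

(** Step [l] preserves the norm of the pivot row and its entries before column [l], so all the mass
    from column [l] on is moved into entry [l]. The right side is the numerator of the pivot
    probability. *)
Lemma arp_iter_pivot_sqr (l : 'I_k) :
  W l.+1 (s l) l ^+ 2 = \sum_(j < k | (l <= j)%N) W l (s l) j ^+ 2.
Proof.
have lk := ltn_ord l.
have gramE i : (i <= k)%N -> \sum_j W i (s l) j ^+ 2 = (V *m V^T) (s l) (s l).
  by move=> ik; rewrite -(arp_iter_gram ik) mxE; apply: eq_bigr => j _; rewrite mxE.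
have trig (j : 'I_k) : (l < j)%N -> W l.+1 (s l) j = 0 by exact: arp_iter_trig.
have head (j : 'I_k) : (j < l)%N -> W l.+1 (s l) j = W l (s l) j.
  move=> jl; have [[u [u0 defH]] _] := reflP (row (s l) (W l)) lk.
  have := mul_reflector_head u0 (row (s l) (W l)) jl.
  by rewrite -defH -row_mul [LHS]mxE [RHS]mxE.
move: trig head (gramE l.+1 lk); rewrite -(gramE l (ltnW lk)).
move: (W l.+1) => U trig head.
rewrite (bigID (fun j : 'I_k => (l <= j)%N)) /=.
rewrite [RHS](bigID (fun j : 'I_k => (l <= j)%N)) /=.
rewrite (bigD1 l) //= big1 ?addr0; last first.
  by move=> j /andP[lj jl]; rewrite trig ?expr0n // ltn_neqAle lj andbT eq_sym.
have -> : \sum_(j < k | ~~ (l <= j)%N) U (s l) j ^+ 2 =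
          \sum_(j < k | ~~ (l <= j)%N) W l (s l) j ^+ 2.
  by apply: eq_bigr => j; rewrite -ltnNge => jl; rewrite head.
by move/addIr.
Qed.

Definition minor (G : 'M[R]_n) i :=
  \det (mxsub (fun a : 'I_i => s a) (fun a : 'I_i => s a) G).

(** The Gram matrix is invariant under the reflectors, and the first [i] pivot rows of [W i] form a
    lower triangular block [L] followed by zeros. Hence the minor is $\det(L)^2$, a product of
    squared diagonal entries. *)
Lemma minor_pivots i : (i <= k)%N ->
  minor (V *m V^T) i =
  \prod_(l < i) \sum_(j < k | (l <= j)%N) W l (s l) j ^+ 2.
Proof.
move=> ik; rewrite /minor.
pose L := \matrix_(a < i, c < i) W i (s a) (widen_ord ik c).
have -> : mxsub (fun a : 'I_i => s a) (fun a : 'I_i => s a) (V *m V^T) = L *m L^T.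
  apply/matrixP => a c; rewrite -(arp_iter_gram ik) !mxE.
  rewrite (bigID (fun j : 'I_k => (j < i)%N)) /= [X in _ + X]big1 ?addr0.
    rewrite (big_ord_narrow ik); apply: eq_bigr => j _; by rewrite !mxE.
  move=> j; rewrite -leqNgt => ij.
  by rewrite arp_iter_trig ?mul0r // (leq_trans (ltn_ord a)).
have L_trig : is_trig_mx L.
  by apply/is_trig_mxP => a c ac; rewrite mxE arp_iter_trig.
rewrite det_mulmx det_tr -expr2 (det_trig L_trig) -prodrXl.
apply: eq_bigr => a _; rewrite mxE.
have ak := leq_trans (ltn_ord a) ik.
rewrite -(arp_iter_pivot_sqr (Ordinal ak)) /=; congr (_ ^+ 2).
have /rowP/(_ (widen_ord ik a)) := arp_iter_pivot_row ik (ltn_ord a).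
by rewrite mxE [RHS]mxE => ->; congr (arp_iter _ _ _ _ _ _); exact: val_inj.
Qed.

Lemma minorS i : (i < k)%N ->
  minor (V *m V^T) i.+1 =
  minor (V *m V^T) i * ((k - i)%:R * pivot_prob refl V s i (s i)).
Proof.
move=> ik; rewrite !minor_pivots ?(ltnW ik) // big_ord_recr /=; congr (_ * _).
by rewrite /pivot_prob mulrC divfK // pnatr_eq0 -lt0n subn_gt0.
Qed.

Lemma minor_ge0 i : (i <= k)%N -> 0 <= minor (V *m V^T) i.
Proof.
move=> ik; rewrite minor_pivots //; apply: prodr_ge0 => l _.
by apply: sumr_ge0 => j _; exact: sqr_ge0.
Qed.

Lemma minor_full : minor (V *m V^T) k = \det (rowsub (fun a : 'I_k => s a) V) ^+ 2.
Proof.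
rewrite expr2 -{2}det_tr -det_mulmx /minor; congr (\det _); apply/matrixP => a c.
by rewrite !mxE; apply: eq_bigr => j _; rewrite !mxE.
Qed.

End Pivots.

(** * The fixed-precision loop *)

(* The projection onto the range of the matrix V of the loop, computed without
   reference to the choices made by [orth]. *)
Fixpoint range_proj (R : realType) m n b (A : 'M[R]_(m, n))
    (Om : nat -> 'M[R]_(m, b)) t : 'M[R]_n :=
  if t is t'.+1 then add_columns (range_proj A Om t') (A^T *m Om t') else 0.

Section Loop.
Variables (R : realType) (orth : orth_fun R).
Hypothesis orthP : orth_spec orth.

(** In exact arithmetic [V1] is already orthogonal to [V], so the second orthogonalization keeps its
    column space, which is that of [M]. *)
Lemma orth_block n k p (V : 'M[R]_(n, k)) (G : 'M[R]_(n, p)) :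
  V^T *m V = 1%:M ->
  let M := G - V *m (V^T *m G) in
  let V1 := orth M in
  let V2 := orth (V1 - V *m (V^T *m V1)) in
  [/\ V2^T *m V2 = 1%:M, V^T *m V2 = 0 & (V2^T :=: M^T)%MS].
Proof.
move=> VV M V1; have [_ V1M] := orthP M; rewrite -/V1 in V1M.
have VM : V^T *m M = 0 by rewrite mulmxBr !mulmxA VV mul1mx subrr.
have V_sub q (U : 'M[R]_(n, q)) : (U^T <= M^T)%MS -> V^T *m U = 0.
  case/submxP=> D UD; apply: trmx_inj.
  by rewrite trmx_mul trmxK UD -mulmxA -[V]trmxK -trmx_mul VM !trmx0 mulmx0.
have VV1 : V^T *m V1 = 0 by apply: V_sub; rewrite V1M.
have V1E : V1 - V *m (V^T *m V1) = V1 by rewrite VV1 mulmx0 subr0.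
move=> V2; have [V2V2 V2V1] := orthP (V1 - V *m (V^T *m V1)).
have V2M : (V2^T :=: M^T)%MS by apply: eqmx_trans V2V1 _; rewrite V1E.
by split=> //; apply: V_sub; rewrite V2M.
Qed.

Variables (m n b : nat) (A : 'M[R]_(m, n)).

Lemma frob2_sub_proj k (V : 'M[R]_(n, k)) : V^T *m V = 1%:M ->
  frob2 (A - A *m (V *m V^T)) = frob2 A - frob2 (V^T *m A^T).
Proof.
move=> VV; apply/esym/eqP; rewrite subr_eq; apply/eqP.
have -> : frob2 (V^T *m A^T) = frob2 (- (A *m V)).
  rewrite -trmx_mul !frob2_trace trmxK mxtrace_mulC linearN /= mulmxN mulNmx.
  by rewrite opprK.
rewrite -(frob2_sub_orthogonal VV).
  by rewrite mulNmx opprK -mulmxA subrK.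
by rewrite mulmxBl -!mulmxA VV mulmx1 subrr.
Qed.

Lemma frob2_col_mx p q r (M : 'M[R]_(p, r)) (N : 'M[R]_(q, r)) :
  frob2 (col_mx M N) = frob2 M + frob2 N.
Proof.
rewrite /frob2 big_split_ord /=.
by congr (_ + _); apply: eq_bigr => i _; apply: eq_bigr => j _;
  rewrite ?col_mxEu ?col_mxEd.
Qed.

(** Ties a state to a projection [Pi] that does not depend on the basis. The last clause lets the
    halting test, stated with the counter, control the factor given by the number of columns plus
    one. *)
Definition loop_inv (Pi : 'M[R]_n) (st : state R m n) :=
  [/\ (st_V st)^T *m st_V st = 1%:M,
      st_B st = (st_V st)^T *m A^T,
      st_E st = frob2 (A - A *m Pi),
      st_V st *m (st_V st)^T = Pi &
      (st_cols st <= st_k st)%N].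

(** Makes the number of columns a measurable function of the Gaussian entries. *)
Lemma loop_inv_trace Pi st : loop_inv Pi st -> \tr Pi = (st_cols st)%:R.
Proof. by case=> VV _ _ <- _; rewrite mxtrace_mulC VV mxtrace1. Qed.

Lemma loop_inv_cols Pi st : loop_inv Pi st -> (st_cols st <= n)%N.
Proof.
case=> VV _ _ _ _; rewrite -{1}(mxrank1 R (st_cols st)) -VV.
exact: leq_trans (mxrankM_maxr _ _) (rank_leq_row _).
Qed.

Lemma init_state_inv : loop_inv 0 (init_state A).
Proof.
split=> //=; first by apply/matrixP => -[].
- by rewrite [RHS]flatmx0.
- by rewrite mulmx0 subr0.
by rewrite mul0mx.
Qed.

(** The new $V V^T$ and [add_columns] are orthogonal projections with the same range, hence equal.
    The number of columns grows by the rank of $(1 - \Pi) A^T \Omega$, which gives the strict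
    increase used for termination. *)
Lemma loop_body_inv Pi st (Om : 'M[R]_(m, b)) : loop_inv Pi st ->
  loop_inv (add_columns Pi (A^T *m Om)) (loop_body orth A Om st) /\
  ((1%:M - Pi) *m (A^T *m Om) != 0 ->
   (st_cols st < st_cols (loop_body orth A Om st))%N).
Proof.
case: st => k V B c E [/= VV -> EE VPi kc]; set G := A^T *m Om.
have [] := orth_block G VV; rewrite /loop_body /= -mulmxA -/G.
(* The width of [V2] is a rank inside a type; it is generalized to a variable [r] so that it can be
   computed separately. *)
clearbody G; set V1 := orth _; move: (orth (V1 - _)).
move: (\rank (V1 - _)) => r V2 V2V2 VV2 V2M.
have GE : G - V *m (V^T *m G) = (1%:M - Pi) *m G.
  by rewrite -VPi mulmxBl mul1mx mulmxA.
have V2G : (V2^T :=: ((1%:M - Pi) *m G)^T)%MS by rewrite -GE.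
have rE : r = \rank ((1%:M - Pi) *m G).
  rewrite -mxrank_tr -V2G; apply/esym/eqP.
  by have /row_freeP := ex_intro (fun D => V2^T *m D = 1%:M) V2 V2V2.
have V2V0 : V2^T *m V = 0.
  by apply: trmx_inj; rewrite trmx_mul trmxK VV2 trmx0.
have WW : (row_mx V V2)^T *m row_mx V V2 = 1%:M.
  by rewrite tr_row_mx mul_col_row VV V2V2 VV2 V2V0 -scalar_mx_block.
have [oPi PiV] := oproj_mul_tr VV; rewrite VPi in oPi PiV.
have WPi : row_mx V V2 *m (row_mx V V2)^T = add_columns Pi G.
  have [oW defW] := oproj_mul_tr WW.
  have [oQ defQ] := add_columnsP G oPi.
  apply: oproj_inj => //; apply: (eqmx_trans defW).
  rewrite tr_row_mx; apply/eqmx_sym/(eqmx_trans defQ).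
  apply: eqmx_trans (addsmxE _ _).
  apply: (@eqmx_trans _ _ _ _ _ _ (Pi + V2^T)%MS); last first.
    exact: adds_eqmx.
  have [Pit _] := oPi.
  have GtE : ((1%:M - Pi) *m G)^T = G^T - G^T *m Pi.
    by rewrite mulmxBl mul1mx linearB /= trmx_mul Pit.
  have sub1 : (G^T *m Pi <= Pi)%MS by exact: submxMl.
  apply/eqmxP/andP; split; rewrite addsmx_sub addsmxSl /=.
    have -> : G^T = ((1%:M - Pi) *m G)^T + G^T *m Pi by rewrite GtE subrK.
    rewrite addmx_sub //; last exact: submx_trans sub1 (addsmxSl _ _).
    by rewrite -V2G addsmxSr.
  rewrite V2G GtE addmx_sub ?addsmxSr // eqmx_opp.
  exact: submx_trans sub1 (addsmxSl _ _).
split; last by rewrite rE -[X in (X < _)%N]addn0 ltn_add2l lt0n mxrank_eq0.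
split=> //=.
- by rewrite tr_row_mx mul_col_mx.
- rewrite -WPi frob2_sub_proj // tr_row_mx mul_col_mx frob2_col_mx opprD addrA.
  by rewrite -frob2_sub_proj // VPi -EE.
- by rewrite leq_add // rE rank_leq_col.
Qed.

Lemma loop_state_inv (Om : nat -> 'M[R]_(m, b)) t :
  loop_inv (range_proj A Om t) (loop_state orth A Om t).
Proof.
elim: t => [|t IHt]; first exact: init_state_inv.
by have [] := loop_body_inv (Om t) IHt.
Qed.

End Loop.

(** * The residual in terms of the projection *)

Section Residual.
Variables (R : realType) (m n : nat) (A : 'M[R]_(m, n)).

(* The residual as a rational function of [V V^T]. *)
Definition proj_residual k (Pi : 'M[R]_n) (J : 'I_k -> 'I_n) : 'M[R]_(m, n) :=
  let G := mxsub J J Pi in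
  A - colsub J A *m ((\det G)^-1 *: \adj G) *m rowsub J Pi.

Lemma mxsub_mul_tr k p (V : 'M[R]_(n, k)) (J : 'I_p -> 'I_n) :
  mxsub J J (V *m V^T) = rowsub J V *m (rowsub J V)^T.
Proof.
by apply/matrixP => a c; rewrite !mxE; apply: eq_bigr => j _; rewrite !mxE.
Qed.

(** With $G = V(J,:) V(J,:)^T$ one has $G^{-1} V(J,:) = V(J,:)^{-T}$. *)
Lemma proj_residualE k (V : 'M[R]_(n, k)) (J : 'I_k -> 'I_n) :
  rowsub J V \in unitmx ->
  proj_residual (V *m V^T) J =
  A - colsub J A *m (invmx (rowsub J V))^T *m V^T.
Proof.
move=> uV; rewrite /proj_residual; set G := mxsub J J _.
have GE : G = rowsub J V *m (rowsub J V)^T by exact: mxsub_mul_tr.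
have uG : G \in unitmx by rewrite GE unitmx_mul unitmx_tr uV.
have -> : (\det G)^-1 *: \adj G = invmx G by rewrite /invmx uG.
have -> : rowsub J (V *m V^T) = rowsub J V *m V^T.
  by apply/matrixP => a c; rewrite !mxE; apply: eq_bigr => j _; rewrite !mxE.
rewrite -!mulmxA; congr (_ - _ *m _); rewrite mulmxA; congr (_ *m _).
rewrite -[RHS](mulKmx uG) {3}GE -(mulmxA (rowsub J V)) -trmx_mul.
by rewrite mulVmx // trmx1 mulmx1.
Qed.

Lemma sum_det_proj_residual k (V : 'M[R]_(n, k)) : V^T *m V = 1%:M ->
  let Pi := V *m V^T in
  \sum_(J : {ffun 'I_k -> 'I_n})
     \det (mxsub J J Pi) * frob2 (proj_residual Pi J) <=
  (k`!)%:R * k.+1%:R * frob2 (A - A *m Pi).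
Proof.
rewrite /= => VV; rewrite mulmxA; apply: le_trans (sum_det_residual VV A).
apply: ler_sum => J _; rewrite mxsub_mul_tr det_mulmx det_tr -expr2.
have [uV|] := boolP (rowsub J V \in unitmx); first by rewrite proj_residualE.
by rewrite unitmxE unitfE negbK => /eqP ->; rewrite expr0n !mul0r.
Qed.

End Residual.

(** * Halting of the loop *)

Section Halting.
Variables (R : realType) (orth : orth_fun R).
Hypothesis orthP : orth_spec orth.
Variables (m n b : nat) (A : 'M[R]_(m, n)) (tau : R).
Hypothesis tau_gt0 : 0 < tau.
Implicit Types Om : nat -> 'M[R]_(m, b).

Lemma st_k_loop_state Om t : st_k (loop_state orth A Om t) = (t * b)%N.
Proof. by elim: t => //= t ->; rewrite mulSn addnC. Qed.

Lemma haltedE Om t : halted tau (loop_state orth A Om t) =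
  (frob2 (A - A *m range_proj A Om t) <= tau / (t * b).+1%:R).
Proof.
have [_ _ EE _ _] := loop_state_inv orthP A Om t.
by rewrite /halted EE st_k_loop_state.
Qed.

Lemma passes_Some Om t : passes orth A tau Om = Some t <->
  halted tau (loop_state orth A Om t) /\
  forall u, (u < t)%N -> ~~ halted tau (loop_state orth A Om u).
Proof.
rewrite /passes; case: pselect => [h|nh]; last first.
  by split=> // -[ht _]; case: nh; exists t.
case: ex_minnP => p hp minp; split.
  by case=> <-; split=> // u; apply: contraL => /minp; rewrite leqNgt.
move=> [ht mint]; congr Some; apply/eqP; rewrite eqn_leq minp //= leqNgt.
by apply/negP => /mint; rewrite hp.
Qed.

Definition stalls Om t :=
  A - A *m range_proj A Om t != 0 /\
  (1%:M - range_proj A Om t) *m (A^T *m Om t) = 0.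

(** Without a stall, every pass either starts from zero residual, where the test succeeds, or adds a
    column. If no state up to pass [n] halted, [n.+1] passes would give more than [n] orthonormal
    columns. *)
Lemma passes_terminates Om : (forall t, ~ stalls Om t) ->
  exists2 t : nat, (t <= n)%N & passes orth A tau Om = Some t.
Proof.
move=> nostall; have [h|nh] :=
  pselect (exists2 t, (t <= n)%N & halted tau (loop_state orth A Om t)).
  have [t tn ht] := h; have ex : exists t, halted tau (loop_state orth A Om t).
    by exists t.
  case: (ex_minnP ex) => p hp minp; exists p; first exact: leq_trans (minp _ ht) tn.
  apply/passes_Some; split=> // u; apply: contraL => /minp.
  by rewrite leqNgt.
exfalso; have grow t : (t <= n.+1)%N -> (t <= st_cols (loop_state orth A Om t))%N.
  elim: t => // t IHt tn; apply: leq_ltn_trans (IHt (ltnW tn)) _.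
  have [_] := loop_body_inv orthP (Om t) (loop_state_inv orthP A Om t).
  apply; apply/eqP => stall; apply: (nostall t); split=> //; apply/eqP => A0.
  case: nh; exists t => //; rewrite haltedE A0.
  rewrite /frob2 big1 ?divr_ge0 ?ltW // => i _.
  by rewrite big1 // => j _; rewrite mxE expr0n.
have := leq_trans (grow n.+1 (leqnn _))
  (loop_inv_cols (loop_state_inv orthP A Om n.+1)).
by rewrite ltnn.
Qed.

End Halting.

(** * Integration on a sub-sigma-algebra *)

Section SubSigmaAlgebra.
Local Open Scope classical_set_scope.
Local Open Scope ereal_scope.
Context d (T : measurableType d) (R : realType).
Variables (C : set (set T)) (mu : {measure set T -> \bar R}).
Hypothesis C_measurable : C `<=` measurable.
(** The space [T] with the sigma-algebra generated by [C], so that measurability for the smaller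
    sigma-algebra is ordinary measurability on [TC]. *)
Let TC : measurableType _ := g_sigma_algebraType C.

Lemma sub_gen_measurable (G : set T) : <<s C >> G -> measurable G.
Proof.
by move: G; apply: smallest_sub => //; exact: sigma_algebra_measurable.
Qed.

Lemma sub_measurable_fun d' (U : measurableType d') (f : T -> U) :
  measurable_fun (setT : set TC) (f : TC -> U) -> measurable_fun setT f.
Proof. by move=> mf _ Y mY; apply: sub_gen_measurable; exact: mf. Qed.

(** Neither [H] nor [S] has to lie in the generated sigma-algebra. By [muE], [g] acts on [H] as the
    conditional probability of [S], tested on sets generated by [C]. *)
Variables (H S : set T) (mH : measurable H) (mS : measurable S).
Variables (g : T -> R).
Hypotheses (g_ge0 : forall x, H x -> (0 <= g x)%R) (mg : measurable_fun H g).
Hypothesis muE : forall G, <<s C >> G ->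
  mu (G `&` H `&` S) = \int[mu]_(x in G `&` H) (g x)%:E.

Import HBNNSimple.

Let integral_density_nnsfun (h : {nnsfun TC >-> R}) :
  \int[mu]_(x in H `&` S) (h x)%:E = \int[mu]_(x in H) (h x * g x)%:E.
Proof.
have mh (r : R) : <<s C >> (h @^-1` [set r]).
  have : measurable (h @^-1` [set r] : set TC) by exact: measurable_funPTI.
  by [].
pose B r : set T := h @^-1` [set r].
have mB r : measurable (B r) by exact: sub_gen_measurable (mh r).
have mHS : measurable (H `&` S) by exact: measurableI.
have hE x : h x = (\sum_(r \in range h) (r * \1_(B r) x))%R by exact: fimfunE.
have B_ge0 r x : 0 <= r%:E * (\1_(B r) x)%:E by exact: nnfun_muleindic_ge0.
under [LHS]eq_integral do rewrite hE -fsumEFin//.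
under [RHS]eq_integral.
  move=> x xH; rewrite hE EFinM -fsumEFin// ge0_mule_fsuml; last first.
    by move=> r; rewrite EFinM.
  over.
have mi r (D : set T) : measurable_fun D (EFin \o (\1_(B r) : T -> R)).
  by apply/measurable_EFinP; exact: measurable_indic.
rewrite ge0_integral_fsum//; last 2 first.
- by move=> r; under eq_fun do rewrite EFinM; exact/measurable_funeM/mi.
- by move=> r x _; rewrite EFinM.
rewrite [RHS]ge0_integral_fsum//; last 2 first.
- move=> r; apply: emeasurable_funM; last exact/measurable_EFinP.
  by under eq_fun do rewrite EFinM; exact/measurable_funeM/mi.
- move=> r x Hx; apply: mule_ge0; last by rewrite lee_fin g_ge0.
  by rewrite EFinM; exact: B_ge0.
apply: eq_fsbigr => r; rewrite inE => -[y _ yr].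
have r0 : (0 <= r)%R by rewrite -yr.
under eq_integral do rewrite EFinM.
under [RHS]eq_integral do rewrite EFinM -muleA.
have mg1 : measurable_fun H (fun x => (\1_(B r) x)%:E * (g x)%:E).
  by apply: emeasurable_funM => //; exact/measurable_EFinP.
rewrite ge0_integralZl//; [|exact: mi].
rewrite [RHS]ge0_integralZl//; last first.
  by move=> x Hx; rewrite mule_ge0 ?lee_fin ?g_ge0.
congr (_ * _); rewrite integral_indic// setIA muE; last exact: mh.
rewrite setIC integral_mkcondr; apply: eq_integral => x _.
by rewrite patchE indicE; case: (x \in B r); rewrite ?mul1e ?mul0e.
Qed.

(** The level sets of a simple function on [TC] can be fed to [muE]; monotone convergence extends
    the identity to nonnegative [f]. *)
Lemma integral_density (f : T -> R) :
  measurable_fun (setT : set TC) (f : TC -> R) -> (forall x, (0 <= f x)%R) ->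
  \int[mu]_(x in H `&` S) (f x)%:E = \int[mu]_(x in H) (f x * g x)%:E.
Proof.
move=> mf f0.
have mHS : measurable (H `&` S) by exact: measurableI.
have mfE : measurable_fun (setT : set TC) (EFin \o f) by exact/measurable_EFinP.
pose h := nnsfun_approx measurableT mfE.
have mh n : measurable_fun setT (h n : T -> R).
  by apply: sub_measurable_fun; exact: measurable_funPT.
have hf x : (h n x)%:E @[n --> \oo] --> (f x)%:E.
  by apply: cvg_nnsfun_approx => // y _; rewrite lee_fin.
have nd_h x : nondecreasing_seq (fun n => (h n x)%:E).
  by move=> p q pq; rewrite lee_fin; exact/lefP/nd_nnsfun_approx.
have -> : \int[mu]_(x in H `&` S) (f x)%:E =
          \int[mu]_(x in H `&` S) limn (fun n => (h n x)%:E).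
  by apply: eq_integral => x _; apply/esym/cvg_lim.
rewrite monotone_convergence//; last 2 first.
- by move=> n; apply/measurable_EFinP/measurable_funTS.
- by move=> n x _; rewrite lee_fin.
have -> : \int[mu]_(x in H) (f x * g x)%:E =
          \int[mu]_(x in H) limn (fun n => (h n x * g x)%:E).
  apply: eq_integral => x xH; apply/esym/cvg_lim => //.
  under eq_fun do rewrite EFinM.
  by rewrite EFinM; apply: cvgeZr.
rewrite monotone_convergence//; last 3 first.
- move=> n; apply/measurable_EFinP/measurable_funM => //.
  exact/measurable_funTS.
- by move=> n x Hx; rewrite lee_fin mulr_ge0 ?g_ge0.
- move=> x Hx p q pq; rewrite lee_fin ler_wpM2r ?g_ge0 //.
  by rewrite -lee_fin; exact: nd_h.
by congr (limn _); apply/funext => n; exact: integral_density_nnsfun.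
Qed.

End SubSigmaAlgebra.

(** * Entrywise measurability of matrix operations *)

Section MeasurableMatrices.
Local Open Scope classical_set_scope.
Context d (T : measurableType d) (R : realType).

(** Inversion is continuous away from 0, and the remaining set is a single point. *)
Lemma measurable_inv (f : T -> R) :
  measurable_fun setT f -> measurable_fun setT (fun x => (f x)^-1).
Proof.
suff mV : measurable_fun setT (@GRing.inv R) by exact: measurableT_comp.
have -> : setT = [set~ 0] `|` [set (0 : R)] by rewrite setUC setUv.
have m0 : measurable [set (0 : R)] by exact: measurable_set1.
apply/measurable_funU => //; first exact: measurableC.
split; last exact: measurable_fun_set1.
apply: open_continuous_measurable_fun; first exact/closed_openC/closed_eq.
by move=> x; rewrite inE /= => /eqP x0; exact: inv_continuous.
Qed.

Definition measurable_mx p q (F : T -> 'M[R]_(p, q)) :=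
  forall i j, measurable_fun setT (fun w => F w i j).

Lemma measurable_mx_cst p q (M : 'M[R]_(p, q)) : measurable_mx (fun=> M).
Proof. by move=> i j; exact: measurable_cst. Qed.

Lemma measurable_mxD p q (F G : T -> 'M[R]_(p, q)) :
  measurable_mx F -> measurable_mx G -> measurable_mx (fun w => F w + G w).
Proof.
move=> mF mG i j; under eq_fun do rewrite mxE.
exact: measurable_funD (mF i j) (mG i j).
Qed.

Lemma measurable_mxB p q (F G : T -> 'M[R]_(p, q)) :
  measurable_mx F -> measurable_mx G -> measurable_mx (fun w => F w - G w).
Proof.
move=> mF mG i j; under eq_fun do rewrite !mxE.
exact: measurable_funB (mF i j) (mG i j).
Qed.

Lemma measurable_mxM p q r (F : T -> 'M[R]_(p, q)) (G : T -> 'M[R]_(q, r)) :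
  measurable_mx F -> measurable_mx G -> measurable_mx (fun w => F w *m G w).
Proof.
move=> mF mG i j; under eq_fun do rewrite mxE.
by apply: measurable_sum => l; apply: measurable_funM; [exact: mF|exact: mG].
Qed.

Lemma measurable_mxZ p q (f : T -> R) (F : T -> 'M[R]_(p, q)) :
  measurable_fun setT f -> measurable_mx F ->
  measurable_mx (fun w => f w *: F w).
Proof.
move=> mf mF i j; under eq_fun do rewrite mxE.
exact: measurable_funM mf (mF i j).
Qed.

Lemma measurable_trmx p q (F : T -> 'M[R]_(p, q)) :
  measurable_mx F -> measurable_mx (fun w => (F w)^T).
Proof. by move=> mF i j; under eq_fun do rewrite mxE; exact: mF. Qed.

Lemma measurable_mxsub p q p' q' (F : T -> 'M[R]_(p, q))
    (f : 'I_p' -> 'I_p) (g : 'I_q' -> 'I_q) :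
  measurable_mx F -> measurable_mx (fun w => mxsub f g (F w)).
Proof. by move=> mF i j; under eq_fun do rewrite mxE; exact: mF. Qed.

Lemma measurable_det p (F : T -> 'M[R]_p) :
  measurable_mx F -> measurable_fun setT (fun w => \det (F w)).
Proof.
move=> mF; rewrite /determinant; apply: measurable_sum => s.
apply: measurable_funM; first exact: measurable_cst.
by apply: measurable_prod => i _; exact: mF.
Qed.

Lemma measurable_adj p (F : T -> 'M[R]_p) :
  measurable_mx F -> measurable_mx (fun w => \adj (F w)).
Proof.
move=> mF i j; under eq_fun do rewrite mxE /cofactor.
apply: measurable_funM; first exact: measurable_cst.
apply: measurable_det => a c; under eq_fun do rewrite !mxE; exact: mF.
Qed.

Lemma measurable_mxtrace p (F : T -> 'M[R]_p) :
  measurable_mx F -> measurable_fun setT (fun w => \tr (F w)).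
Proof. by move=> mF; apply: measurable_sum => i; exact: mF. Qed.

Lemma measurable_frob2 p q (F : T -> 'M[R]_(p, q)) :
  measurable_mx F -> measurable_fun setT (fun w => frob2 (F w)).
Proof.
move=> mF; apply: measurable_sum => i; apply: measurable_sum => j.
exact: measurable_funX (mF i j).
Qed.

Lemma measurable_gram_schmidt n (F : T -> 'M[R]_n) (c : T -> 'cV[R]_n) :
  measurable_mx F -> measurable_mx c ->
  measurable_mx (fun w => gram_schmidt (F w) (c w)).
Proof.
move=> mF mc; rewrite /gram_schmidt.
have mr : measurable_mx (fun w => c w - F w *m c w).
  by apply: measurable_mxB => //; exact: measurable_mxM.
apply: measurable_mxD => //; apply: measurable_mxZ.
  apply: measurable_inv.
  exact: (measurable_mxM (measurable_trmx mr) mr).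
exact: measurable_mxM mr (measurable_trmx mr).
Qed.

Lemma measurable_add_columns n p (F : T -> 'M[R]_n) (M : T -> 'M[R]_(n, p)) :
  measurable_mx F -> measurable_mx M ->
  measurable_mx (fun w => add_columns (F w) (M w)).
Proof.
elim: p => [|p IHp] in F M *; first by [].
move=> mF mM /=; apply: IHp.
  apply: measurable_gram_schmidt => //.
  by move=> i j; under eq_fun do rewrite mxE; exact: mM.
by move=> i j; under eq_fun do rewrite mxE; exact: mM.
Qed.

Lemma measurable_range_proj m n b (A : 'M[R]_(m, n))
    (Om : T -> nat -> 'M[R]_(m, b)) t :
  (forall u, (u < t)%N -> measurable_mx (fun w => Om w u)) ->
  measurable_mx (fun w => range_proj A (Om w) t).
Proof.
elim: t => [|t IHt] mOm /=; first exact: measurable_mx_cst.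
apply: measurable_add_columns; first by apply: IHt => u ut; apply/mOm/ltnW.
by apply: measurable_mxM; [exact: measurable_mx_cst|exact: mOm].
Qed.

Lemma measurable_proj_residual m n k (A : 'M[R]_(m, n)) (F : T -> 'M[R]_n)
    (J : 'I_k -> 'I_n) :
  measurable_mx F -> measurable_mx (fun w => proj_residual A (F w) J).
Proof.
move=> mF; apply: measurable_mxB; first exact: measurable_mx_cst.
have mG := measurable_mxsub J J mF.
apply: measurable_mxM; last exact: measurable_mxsub.
apply: measurable_mxM; first exact: measurable_mx_cst.
apply: measurable_mxZ; last exact: measurable_adj.
exact/measurable_inv/measurable_det.
Qed.

End MeasurableMatrices.

(** * Independence *)

Section Independence.
Local Open Scope classical_set_scope.
Local Open Scope ereal_scope.
Context d (T : measurableType d) (R : realType) (P : probability T R).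
Context (I : choiceType) (X : I -> {RV P >-> R}).
Hypothesis X_indep : mutually_independent X.
Variable a0 : I.

Definition other_events : set (set T) :=
  [set G | exists a (Y : set R), [/\ a != a0, measurable Y & G = X a @^-1` Y]].

(** Finite cylinders avoiding [a0]: a pi-system containing the generators [other_events], on which
    independence can be read from the hypothesis. *)
Let other_rects : set (set T) :=
  [set G | exists (J : seq I) (Y : I -> set R),
    [/\ uniq J, a0 \notin J, forall a, measurable (Y a) &
        G = \bigcap_(a in [set` J]) (X a @^-1` Y a)]].

Let other_rects_setI : setI_closed other_rects.
Proof.
move=> _ _ [J [Y [uJ aJ mY ->]]] [K [Z [uK aK mZ ->]]].
(* An index present in only one of the two lists is left unconstrained by the other. *)
exists (undup (J ++ K)), (fun a => (if a \in J then Y a else setT) `&`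
                             (if a \in K then Z a else setT)); split.
- exact: undup_uniq.
- by rewrite mem_undup mem_cat negb_or aJ aK.
- by move=> a; apply: measurableI; case: ifP.
apply/seteqP; split=> [w [wY wZ] a _|w wJK].
  by split; case: ifP => // aE; [exact: wY|exact: wZ].
split=> a /= aE; have [] := wJK a; rewrite /= ?mem_undup ?mem_cat aE ?orbT //.
Qed.

Let other_rects_measurable : other_rects `<=` measurable.
Proof.
move=> _ [J [Y [_ _ mY ->]]]; apply: fin_bigcap_measurable; first exact: finite_seq.
by move=> a _; exact: measurable_funPTI.
Qed.

Lemma other_events_measurable : other_events `<=` measurable.
Proof. by move=> _ [a [Y [_ mY ->]]]; exact: measurable_funPTI. Qed.

(** Dynkin induction: for cylinders, adjoin [a0] to the index list and apply mutual independence;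
    the identity passes to complements and disjoint unions. *)
Lemma independent_other_events (Z : set R) (G : set T) :
  measurable Z -> <<s other_events >> G ->
  P (X a0 @^-1` Z `&` G) = P (X a0 @^-1` Z) * P G.
Proof.
move=> mZ sG; set B := X a0 @^-1` Z.
have mB : measurable B by exact: measurable_funPTI.
have {}sG : <<s other_rects >> G.
  apply: sub_sigma_algebra2 sG => _ [a [Y [aa0 mY ->]]].
  exists [:: a], (fun=> Y); split=> //; first by rewrite inE eq_sym.
  by rewrite set_cons1 bigcap_set1.
have mS S : <<s other_rects >> S -> measurable S by exact: sub_gen_measurable.
pose TG : measurableType _ := g_sigma_algebraType other_rects.
apply: (@dynkin_induction _ TG other_rects (fun S => P (B `&` S) = P B * P S)).
- by [].
- exact: other_rects_setI.
- by rewrite setIT probability_setT mule1.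
- move=> _ [J [Y [uJ aJ mY ->]]].
  have := X_indep (J := a0 :: J) (Y := fun a => if a == a0 then Z else Y a).
  rewrite /= aJ uJ big_cons eqxx => /(_ isT).
  have -> : \bigcap_(a in [set` (a0 :: J)])
      X a @^-1` (if a == a0 then Z else Y a) =
      B `&` \bigcap_(a in [set` J]) X a @^-1` Y a.
    apply/seteqP; split=> [w wJ|w [wB wJ] a /=]; last first.
      by rewrite inE; case: eqP => [->//|_ /=]; exact: wJ.
    split=> [|a /= aJ']; first by have := wJ a0; rewrite /= mem_head eqxx; exact.
    have := wJ a; rewrite /= inE aJ' orbT.
    by case: eqP => [aa0|_]; [rewrite aa0 (negPf aJ) in aJ'|exact].
  move=> ->; last by move=> a; case: ifP.
  congr (_ * _); rewrite X_indep //; apply: eq_big_seq => a aJ'.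
  by case: eqP => // aa0; rewrite aa0 (negPf aJ) in aJ'.
- move=> S /mS mS' PS.
  have PB : P B < +oo by rewrite ltey_eq fin_num_measure.
  rewrite -setDE measureD // [X in _ - X]PS.
  by rewrite probability_setC // muleBr ?mule1 ?fin_num_measure // fin_num_adde_defr.
- move=> F mF tF PF; have mF' k : measurable (F k : set T) by apply: mS; exact: mF.
  rewrite setI_bigcupr measure_bigcup //; last 2 first.
  + by move=> k _; exact: measurableI.
  + exact: trivIset_setIl.
  rewrite measure_bigcup // -[P B]fineK ?fin_num_measure // -nneseriesZl //.
  apply: eq_eseriesr => k _; rewrite fineK ?fin_num_measure //; exact: PF.
by [].
Qed.

(* The joint law is a product, so Fubini integrates the atoms of [X a0] over the
   diagonal. *)
Lemma independent_eq_null (Y : T -> R) :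
  measurable_fun (setT : set (g_sigma_algebraType other_events))
    (Y : g_sigma_algebraType other_events -> R) ->
  (forall r, P (X a0 @^-1` [set r]) = 0) ->
  P [set w | X a0 w = Y w] = 0.
Proof.
move=> mY X0; have mYT : measurable_fun setT Y.
  by apply: sub_measurable_fun mY; exact: other_events_measurable.
pose Y' : {RV P >-> R} := mfun_Sub (mem_set mYT).
have mYX : measurable_fun setT (fun w => (Y' w, X a0 w)).
  by apply: measurable_fun_pair; exact: measurable_funPT.
pose YX : {mfun T >-> (R * R)%type} := mfun_Sub (mem_set mYX).
pose D : set (R * R) := [set p | p.1 = p.2].
have mD : measurable D.
  have := measurable_fun_eqr (@measurable_fst _ _ R R) (@measurable_snd _ _ R R).
  move=> /(_ measurableT [set true]); rewrite setTI.
  rewrite (_ : _ @^-1` _ = D); first exact.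
  by apply/seteqP; split=> p /= /eqP.
have rect A B : measurable A -> measurable B ->
    distribution P YX (A `*` B) = distribution P Y' A * distribution P (X a0) B.
  move=> mA mB; rewrite /distribution /pushforward /= muleC.
  rewrite -independent_other_events //; last by have := mY measurableT A mA; rewrite setTI.
  by congr (P _); apply/seteqP; split=> w /= [].
transitivity (distribution P YX D).
  by congr (P _); apply/seteqP; split=> w /esym.
rewrite -(product_measure_unique rect mD) /product_measure1 integral0_eq // => x _ /=.
rewrite (_ : xsection D x = [set x]); first exact: X0.
by apply/seteqP; split=> y; rewrite /xsection /= inE /D /=.
Qed.

End Independence.

(** * The law of the pivots *)

Section MoreIntegration.
Local Open Scope classical_set_scope.
Local Open Scope ereal_scope.
Context d (T : measurableType d) (R : realType).
Variable mu : {measure set T -> \bar R}.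

Import HBNNSimple.

(* The integral of a nonnegative function is a supremum over simple functions
   below it. The error is compared with a measurable bound in this way, because
   nothing makes the choices of [orth] and of the pivots measurable. *)
Lemma le_lower_integral (f g : T -> \bar R) :
  (forall x, 0 <= f x) -> (forall x, f x <= g x) ->
  \int[mu]_x f x <= \int[mu]_x g x.
Proof.
move=> f0 fg; have g0 x : 0 <= g x by exact: le_trans (f0 x) (fg x).
rewrite !ge0_integralTE //; apply: le_ereal_sup => _ [h /= hf <-].
by exists h => // x; exact: le_trans (hf x) (fg x).
Qed.

End MoreIntegration.

Section PivotPath.
Variables (R : realType) (refl : reflector_fun R) (n k : nat).
Variables (V : 'M[R]_(n, k)) (s s' : nat -> 'I_n) (i : nat).
Hypothesis ss' : forall l, (l < i)%N -> s l = s' l.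

Lemma pivot_prob_ext j : pivot_prob refl V s i j = pivot_prob refl V s' i j.
Proof.
suff E : arp_iter refl V s i = arp_iter refl V s' i by rewrite /pivot_prob E.
elim: i ss' => // l IHl ssl /=; rewrite IHl; last by move=> c cl; apply/ssl/ltnW.
by rewrite ssl.
Qed.

Lemma minor_ext (G : 'M[R]_n) : minor s G i = minor s' G i.
Proof.
by congr (\det _); apply/matrixP => a c; rewrite !mxE !ss'.
Qed.

End PivotPath.

Section RandomizedPivoting.
Local Open Scope classical_set_scope.
Local Open Scope ereal_scope.
Variables (R : realType) (orth : orth_fun R) (refl : reflector_fun R).
Hypotheses (orthP : orth_spec orth) (reflP : reflector_spec refl).
Variables (m n b : nat) (A : 'M[R]_(m, n)) (tau : R).
Hypothesis tau_gt0 : (0 < tau)%R.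
Context d (T : measurableType d) (P : probability T R).
Variables (X : nat -> 'I_m -> 'I_b -> {RV P >-> R}) (s : nat -> T -> 'I_n).

Local Notation Pi t w := (range_proj A (gauss_mx X w) t).
Local Notation st t w := (loop_state orth A (gauss_mx X w) t).

Lemma measurable_range_proj_gauss (C : set (set T)) t :
  (forall u a c (Y : set R), (u < t)%N -> measurable Y -> C (X u a c @^-1` Y)) ->
  measurable_mx (fun w : g_sigma_algebraType C => Pi t w).
Proof.
move=> CX; apply: measurable_range_proj => u ut i j.
under eq_fun do rewrite mxE.
by move=> _ Y mY; rewrite setTI; apply: sub_gen_smallest; exact: CX.
Qed.

(** The part of the past without pivots: the minors, the halting tests and the error as a function
    of the projection all live on its sigma-algebra. *)
Definition draws t : set (set T) :=
  [set G | exists u a c (Y : set R),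
     [/\ (u < t)%N, measurable Y & G = X u a c @^-1` Y]].

Lemma draws_measurable t : draws t `<=` measurable.
Proof. by move=> _ [u [a [c [Y [_ mY ->]]]]]; exact: measurable_funPTI. Qed.

Lemma draws_past t i G : <<s draws t >> G -> past X s t i G.
Proof.
by apply: sub_sigma_algebra2 => {}G [u [a [c [Y H]]]]; left; exists u, a, c, Y.
Qed.

Lemma measurable_draws_range_proj u t : (u <= t)%N ->
  measurable_mx (fun w : g_sigma_algebraType (draws t) => Pi u w).
Proof.
move=> ut; apply: measurable_range_proj_gauss => v a c Y vu mY.
by exists v, a, c, Y; split=> //; exact: leq_trans ut.
Qed.

Definition stops t k : set T :=
  [set w | passes orth A tau (gauss_mx X w) = Some t /\ st_cols (st t w) = k].

(** The matrix [V] may depend non-measurably on the draws, but the halting tests are functions of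
    the projections, and the number of columns is a trace. *)
Lemma draws_stops t k : <<s draws t >> (stops t k).
Proof.
pose TD : measurableType _ := g_sigma_algebraType (draws t).
have mhalt u : (u <= t)%N ->
    measurable ([set w | halted tau (st u w)] : set TD).
  move=> ut.
  have mE : measurable_fun setT (fun w : TD => frob2 (A - A *m Pi u w)).
    apply: measurable_frob2; apply: measurable_mxB; first exact: measurable_mx_cst.
    apply: measurable_mxM; first exact: measurable_mx_cst.
    exact: measurable_draws_range_proj.
  have := measurable_fun_ler mE (@measurable_cst _ _ TD _ setT (tau / (u * b).+1%:R)%R).
  move=> /(_ measurableT [set true]); rewrite setTI.
  rewrite (_ : _ @^-1` _ = [set w | halted tau (st u w)]); first exact.
  by apply/seteqP; split=> w /=; rewrite haltedE.
have mcols : measurable ([set w | st_cols (st t w) = k] : set TD).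
  have mtr : measurable_fun setT (fun w : TD => \tr (Pi t w)).
    by apply: measurable_mxtrace; exact: measurable_draws_range_proj.
  have := mtr measurableT [set k%:R%R] (measurable_set1 _); rewrite setTI.
  rewrite (_ : _ @^-1` _ = [set w | st_cols (st t w) = k]) //.
  apply/seteqP; split=> w /=; rewrite (loop_inv_trace (loop_state_inv orthP A _ t)).
    by move/eqP; rewrite eqr_nat => /eqP.
  by move=> ->.
have -> : stops t k = [set w | st_cols (st t w) = k] `&`
   ([set w | halted tau (st t w)] `&`
    \bigcap_(u in `I_t) ~` [set w | halted tau (st u w)]).
  apply/seteqP; split=> w.
    by move=> [/passes_Some[ht nh] ck]; split=> //; split=> // u /= /nh/negP.
  move=> [ck [ht nh]]; split=> //; apply/passes_Some; split=> // u ut.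
  by apply/negP; exact: nh.
have : measurable ([set w | st_cols (st t w) = k] `&`
   ([set w | halted tau (st t w)] `&`
    \bigcap_(u in `I_t) ~` [set w | halted tau (st u w)]) : set TD).
  apply: measurableI => //; apply: measurableI; first exact: mhalt.
  apply: fin_bigcap_measurable; first exact: finite_II.
  by move=> u /= ut; apply: measurableC; apply: mhalt; exact: ltnW.
by [].
Qed.

Hypothesis s_sampled : pivots_sampled orth refl A tau X s.

Definition starts (J : nat -> 'I_n) i : set T :=
  [set w | forall l, (l < i)%N -> s l w = J l].

Lemma startsS J i : starts J i.+1 = starts J i `&` s i @^-1` [set J i].
Proof.
apply/seteqP; split=> w.
  by move=> sJ; split=> [l li|]; [exact/sJ/ltnW|exact: sJ].
move=> [sJ sJi] l; rewrite ltnS leq_eqVlt => /predU1P[->|]; first exact: sJi.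
exact: sJ.
Qed.

Lemma pastI t i G H : past X s t i G -> past X s t i H -> past X s t i (G `&` H).
Proof.
rewrite /past; set C := (X in <<s X >>) => sG sH.
have : measurable (G `&` H : set (g_sigma_algebraType C)) by exact: measurableI.
by [].
Qed.

Lemma past_starts J t i : past X s t i (starts J i).
Proof.
have -> : starts J i = \bigcap_(l in `I_i) (s l @^-1` [set J l]).
  by apply/seteqP; split=> w sJ l; exact: sJ.
rewrite /past; set C := (X in <<s X >>).
have : measurable (\bigcap_(l in `I_i) (s l @^-1` [set J l]) :
    set (g_sigma_algebraType C)).
  apply: fin_bigcap_measurable; first exact: finite_II.
  by move=> l li; apply: sub_gen_smallest; right; exists l, (J l).
by [].
Qed.

Lemma measurable_starts J i : measurable (starts J i).
Proof.
elim: i => [|i IHi]; last first.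
  by rewrite startsS; apply: measurableI => //; exact: s_sampled.1.
by rewrite (_ : starts J 0 = setT) //; apply/seteqP; split.
Qed.

Lemma measurable_stops t k : measurable (stops t k).
Proof.
by apply: (sub_gen_measurable (@draws_measurable t)); exact: draws_stops.
Qed.

Lemma minor_stops_ge0 J t k i w :
  stops t k w -> (i <= k)%N -> (0 <= minor J (Pi t w) i)%R.
Proof.
move=> [_ <-] ik; have [_ _ _ <- _] := loop_state_inv orthP A (gauss_mx X w) t.
exact: (minor_ge0 reflP).
Qed.

Lemma minor_pivot_prob J t k i w :
  stops t k w -> (i < k)%N -> starts J i w ->
  minor J (Pi t w) i.+1 = (minor J (Pi t w) i *
    ((k - i)%:R * pivot_prob refl (st_V (st t w)) (s^~ w) i (J i)))%R.
Proof.
move=> [_ <-] ik sJ; have [_ _ _ <- _] := loop_state_inv orthP A (gauss_mx X w) t.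
by rewrite (minorS reflP) // (pivot_prob_ext _ _ sJ).
Qed.

Lemma measurable_minor J t i :
  measurable_fun (setT : set (g_sigma_algebraType (draws t)))
    (fun w : g_sigma_algebraType (draws t) => minor J (Pi t w) i).
Proof.
apply: measurable_det; apply: measurable_mxsub.
exact: measurable_draws_range_proj.
Qed.

(** Applies the sampling rule to [G] intersected with [stops t k], where the existence of pivot [i]
    follows from $i < k$. *)
Lemma sampled_stops t k i (j : 'I_n) G : (i < k)%N -> past X s t i G ->
  P (G `&` stops t k `&` s i @^-1` [set j]) =
  \int[P]_(w in G `&` stops t k)
     (pivot_prob refl (st_V (st t w)) (s^~ w) i j)%:E.
Proof.
move=> ik pG.
have pD : past X s t i (G `&` stops t k).
  by apply: pastI => //; apply: draws_past; exact: draws_stops.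
have -> : G `&` stops t k = G `&` stops t k `&`
    [set w | passes orth A tau (gauss_mx X w) = Some t /\
             (i < st_cols (st t w))%N].
  apply/seteqP; split=> w; last by case.
  by move=> [Gw [pw ck]]; split=> //; split=> //; rewrite ck.
exact: s_sampled.2 t i j _ pD.
Qed.

Lemma minor0 J (G : 'M[R]_n) : minor J G 0 = 1%R.
Proof. exact: det_mx00. Qed.

(** The density is tested against arbitrary nonnegative [f] determined by the draws, because the
    induction on [i] applies its hypothesis to [f] times the next pivot probability, again such a
    function. *)
Lemma pivot_law t k J i (f : T -> R) : (i <= k)%N ->
  measurable_fun (setT : set (g_sigma_algebraType (draws t)))
    (f : g_sigma_algebraType (draws t) -> R) ->
  (forall w, (0 <= f w)%R) ->
  \int[P]_(w in stops t k `&` starts J i) (f w)%:E =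
  \int[P]_(w in stops t k) (f w * (minor J (Pi t w) i / (k ^_ i)%:R))%:E.
Proof.
pose TD : measurableType _ := g_sigma_algebraType (draws t).
have mT (g : T -> R) : measurable_fun (setT : set TD) (g : TD -> R) ->
    forall D, measurable_fun D g.
  move=> mg D; apply: measurable_funTS.
  exact: sub_measurable_fun (@draws_measurable t) _ _ _ mg.
have mD := measurable_stops t k.
elim: i f => [|i IHi] f ik mf f0.
  rewrite (_ : starts J 0 = setT); last by apply/seteqP; split.
  by rewrite setIT; apply: eq_integral => w _; rewrite minor0 ffactn0 divr1 mulr1.
pose mi w : R := minor J (Pi t w) i.
pose mi1 w : R := minor J (Pi t w) i.+1.
have mmi : measurable_fun (setT : set TD) (mi : TD -> R) by exact: measurable_minor.
have mmi1 : measurable_fun (setT : set TD) (mi1 : TD -> R) by exact: measurable_minor.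
(* Only on [U] can the pivot probability be recovered as a quotient of consecutive minors. *)
pose U : set T := mi @^-1` [set~ 0%R].
have sU : <<s draws t >> U.
  have : measurable (U : set TD).
    rewrite -[X in measurable X]setTI; apply: mmi => //.
    by apply: measurableC; exact: measurable_set1.
  by [].
have mU : measurable U by exact: sub_gen_measurable (@draws_measurable t) _ sU.
have mS := measurable_starts J i.
have mSi : measurable (s i @^-1` [set J i]) by exact: s_sampled.1.
(* Nonnegative where it matters; the absolute value makes it so everywhere. *)
pose q (w : T) : R := `|mi1 w / (mi w * (k - i)%:R)|%R.
have mq : measurable_fun (setT : set TD) (q : TD -> R).
  apply: measurableT_comp => //; apply: measurable_funM => //.
  by apply: measurable_inv; apply: measurable_funM => //; exact: measurable_cst.
have q_prob w : stops t k w -> starts J i w -> U w ->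
    pivot_prob refl (st_V (st t w)) (s^~ w) i (J i) = q w.
  move=> Dw Sw Uw; have mi0 : mi w != 0%R by apply/eqP; exact: Uw.
  have ki0 : (k - i)%:R != 0%R :> R by rewrite pnatr_eq0 -lt0n subn_gt0.
  have mi1_ge0 : (0 <= mi1 w)%R by exact: minor_stops_ge0 Dw ik.
  have mi_ge0 : (0 <= mi w)%R by exact: minor_stops_ge0 Dw (ltnW ik).
  rewrite /q ger0_norm; last by rewrite divr_ge0 // mulr_ge0.
  rewrite /mi1 (minor_pivot_prob Dw ik Sw) -/(mi w) mulrA mulrAC divff ?mul1r //.
  by rewrite mulf_neq0.
pose H := stops t k `&` starts J i `&` U.
have mH : measurable H by apply: measurableI => //; exact: measurableI.
have HS G : <<s draws t >> G ->
    P (G `&` H `&` s i @^-1` [set J i]) = \int[P]_(w in G `&` H) (q w)%:E.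
  move=> sG; have -> : G `&` H = (G `&` (starts J i `&` U)) `&` stops t k.
    by rewrite /H -setIA [RHS]setIC [in RHS]setICA.
  rewrite sampled_stops //; last first.
    apply: pastI; first exact: draws_past.
    by apply: pastI; [exact: past_starts|exact: draws_past].
  apply: eq_integral => w; rewrite inE => -[[_ [Sw Uw]] Dw].
  by rewrite q_prob.
have int1 := integral_density (@draws_measurable t) mH mSi
  (fun w _ => normr_ge0 _) (mT _ mq H) HS mf f0.
pose E := stops t k `&` starts J i.+1.
have mE : measurable E by apply: measurableI => //; exact: measurable_starts.
have mfE D : measurable_fun D (fun w => (f w)%:E).
  by apply/measurable_EFinP; exact: mT.
have f0E w : 0 <= (f w)%:E by rewrite lee_fin.
have EU : E `&` U = H `&` s i @^-1` [set J i].
  by rewrite /E startsS /H -!setIA [U `&` _]setIC.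
have mind (B : set T) : <<s draws t >> B ->
    measurable_fun (setT : set TD) (\1_B : TD -> R).
  by move=> sB; apply: measurable_indic.
have mi1_0 w : stops t k w -> mi w = 0%R -> mi1 w = 0%R.
  move=> [_ ck] mi0; have [_ _ _ VPi _] := loop_state_inv orthP A (gauss_mx X w) t.
  by rewrite /mi1 -VPi (minorS reflP) ?ck // VPi -/(mi w) mi0 mul0r.
(* Dropping the last pivot enlarges the domain; there the induction hypothesis, applied to [f] times
   the indicator of the complement of [U], integrates a vanishing density. *)
have intU : \int[P]_(w in E `&` ~` U) (f w)%:E = 0.
  apply/eqP; rewrite eq_le integral_ge0 ?andbT //.
  apply: (@le_trans _ _ (\int[P]_(w in stops t k `&` starts J i `&` ~` U) (f w)%:E)).
    apply: ge0_subset_integral => //.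
    - by apply: measurableI => //; exact: measurableC.
    - by apply: measurableI; [exact: measurableI|exact: measurableC].
    - by apply: setSI; rewrite /E startsS setIA; exact: subIsetl.
  rewrite integral_mkcondr.
  under eq_integral.
    move=> w _; rewrite (_ : _ w = (f w * \1_(~` U) w)%:E); last first.
      by rewrite patchE indicE; case: (w \in _); rewrite ?mulr1 ?mulr0.
    over.
  rewrite IHi ?(ltnW ik) //; last 2 first.
  - apply: measurable_funM => //; apply: mind.
    exact: (@measurableC _ TD).
  - by move=> w; rewrite mulr_ge0.
  rewrite integral0_eq // => w _; rewrite indicE.
  case: (boolP (w \in ~` U)) => [|_]; last by rewrite mulr0 mul0r.
  by rewrite inE => /contrapT mi0; rewrite -/(mi w) mi0 mul0r mulr0.
rewrite -[X in \int[P]_(w in X) _ = _]setIT -(setUv U) setIUr -/E.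
rewrite ge0_integral_setU //; last 3 first.
- exact: measurableI.
- by apply: measurableI => //; exact: measurableC.
- by rewrite disj_set2E setIACA setICr setI0.
rewrite intU adde0 EU int1 /H integral_mkcondr.
under eq_integral.
  move=> w _; rewrite (_ : _ w = (f w * q w * \1_U w)%:E); last first.
    by rewrite patchE indicE; case: (w \in _); rewrite ?mulr1 ?mulr0.
  over.
rewrite IHi ?(ltnW ik) //; last 2 first.
- by apply: measurable_funM; [exact: measurable_funM|exact: mind].
- by move=> w; rewrite !mulr_ge0 ?normr_ge0.
apply: eq_integral => w; rewrite inE => Dw; congr (_%:E).
rewrite -/(mi w) -/(mi1 w) indicE; case: (boolP (w \in U)); last first.
  by rewrite notin_setE => /contrapT mi0; rewrite mi1_0 // mulr0 !mul0r mulr0.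
rewrite inE => Uw; have mi0 : mi w != 0%R by apply/eqP.
have ki0 : (k - i)%:R != 0%R :> R by rewrite pnatr_eq0 -lt0n subn_gt0.
have mi1_ge0 : (0 <= mi1 w)%R by exact: minor_stops_ge0 Dw ik.
have mi_ge0 : (0 <= mi w)%R by exact: minor_stops_ge0 Dw (ltnW ik).
rewrite mulr1 /q ger0_norm; last by rewrite divr_ge0 // mulr_ge0.
have fi0 : (k ^_ i)%:R != 0%R :> R by rewrite pnatr_eq0 -lt0n ffact_gt0 ltnW.
(* The falling factorial gains exactly the factor $k - i$ from the denominator of [q]. *)
rewrite ffactnSr natrM; field.
by rewrite fi0 ki0 mi0.
Qed.

End RandomizedPivoting.

(** * Almost sure termination *)

Lemma negligible_fin_bigcup d (T : measurableType d) (R : realType)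
    (mu : {measure set T -> \bar R}) (I : finType) (F : I -> set T) :
  (forall i, mu.-negligible (F i)) ->
  mu.-negligible [set w | exists i, F i w].
Proof.
move=> nF; apply: (@negligibleS _ _ _ _ (\big[setU/set0]_(i : I) F i)).
  by move=> w [i Fi]; rewrite (bigD1 i) //=; left.
by elim/big_ind : _ => //; [exact: negligible_set0|move=> A B; exact: negligibleU].
Qed.

Lemma range_proj_oproj (R : realType) m n b (A : 'M[R]_(m, n))
    (Om : nat -> 'M[R]_(m, b)) t : is_oproj (range_proj A Om t).
Proof.
elim: t => [|t IHt] /=; first by split; rewrite ?trmx0 ?mulmx0.
by have [] := add_columnsP (A^T *m Om t) IHt.
Qed.

Section Stalling.
Local Open Scope classical_set_scope.
Variables (R : realType) (m n b : nat) (A : 'M[R]_(m, n)).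
Context d (T : measurableType d) (P : probability T R).
Variable X : nat -> 'I_m -> 'I_b -> {RV P >-> R}.
Hypothesis X_iid : iid_std_normal
  (fun a : nat * 'I_m * 'I_b => X a.1.1 a.1.2 a.2).
Hypothesis b_gt0 : (0 < b)%N.

Local Notation Pi t w := (range_proj A (gauss_mx X w) t).

Lemma std_normal_atomless (a : nat * 'I_m * 'I_b) r :
  P (X a.1.1 a.1.2 a.2 @^-1` [set r]) = 0%E.
Proof.
rewrite -[LHS]/(distribution P (X a.1.1 a.1.2 a.2) [set r]) X_iid.2 //.
have /null_content_dominatesP := @normal_prob_dominates R 0 1.
by apply => //; exact: lebesgue_measure_set1.
Qed.

(* If the block vanishes, then the first column of the fresh Gaussian matrix
   solves a nontrivial linear equation determined by the past, which fixes one
   entry in terms of the others. *)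
Lemma stalls_negligible t :
  P.-negligible [set w | stalls A (gauss_mx X w) t].
Proof.
pose c0 := Ordinal b_gt0.
pose M w : 'M[R]_(n, m) := (1%:M - Pi t w) *m A^T.
pose Y i j w : R := - ((M w i j)^-1 * \sum_(l < m | l != j) M w i l * X t l c0 w).
apply: (@negligibleS _ _ _ _
    [set w | exists p : 'I_n * 'I_m, X t p.2 c0 w = Y p.1 p.2 w]).
  move=> w [A0 stall].
  (* The transpose of [M w] is the residual $A - A \Pi$, which is nonzero at a stall. *)
  have [i [j Mij]] : exists i j, M w i j != 0.
    apply: contrapT => /forallNP M0; case/negP: A0; apply/eqP.
    have [Pit _] := range_proj_oproj A (gauss_mx X w) t.
    have M00 : M w = 0.
      apply/matrixP => i j; rewrite [RHS]mxE; apply/eqP/negbNE/negP => Mij.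
      by apply: (M0 i); exists j.
    apply: trmx_inj; rewrite linearB /= trmx_mul Pit trmx0 -M00 /M.
    by rewrite mulmxBl mul1mx.
  exists (i, j) => /=.
  have := congr1 (fun N : 'M[R]_(n, b) => N i c0) stall.
  have gE l : gauss_mx X w t l c0 = X t l c0 w by rewrite mxE.
  rewrite mulmxA -/(M w) mxE [RHS]mxE; under eq_bigr do rewrite gE.
  rewrite (bigD1 j) //= => /eqP; rewrite addr_eq0 => /eqP E.
  by rewrite /Y -mulrN -E mulKf.
apply: negligible_fin_bigcup => -[i j] /=.
pose a0 : nat * 'I_m * 'I_b := (t, j, c0).
pose XX (a : nat * 'I_m * 'I_b) := X a.1.1 a.1.2 a.2.
have XE v a c Z : (v, a, c) != a0 -> measurable Z ->
    other_events XX a0 (X v a c @^-1` Z).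
  by move=> va mZ; exists (v, a, c), Z.
have mM : measurable_mx (fun w : g_sigma_algebraType (other_events XX a0) => M w).
  apply: measurable_mxM; last exact: measurable_mx_cst.
  apply: measurable_mxB; first exact: measurable_mx_cst.
  apply: measurable_range_proj_gauss => v a c Z vt mZ; apply: XE => //.
  by apply/eqP => -[vt' _ _]; rewrite vt' ltnn in vt.
have mY : measurable_fun setT (Y i j : g_sigma_algebraType (other_events XX a0) -> R).
  apply: measurable_funN; apply: measurable_funM.
    by apply: measurable_inv; exact: mM.
  rewrite (_ : (fun _ => _) = (fun w => \sum_(l < m)
      if l != j then M w i l * X t l c0 w else 0)); last first.
    by apply/funext => w; rewrite -big_mkcond.
  apply: measurable_sum => l; case: (boolP (l != j)) => lj; last exact: measurable_cst.
  apply: measurable_funM; first exact: mM.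
  move=> _ Z mZ; rewrite setTI; apply: sub_gen_smallest; apply: XE => //.
  by apply/eqP => -[lj']; rewrite lj' eqxx in lj.
have null : P [set w | XX a0 w = Y i j w] = 0%E.
  by apply: independent_eq_null X_iid.1 _ _ mY _; exact: std_normal_atomless.
apply/negligibleP => //.
have mYT : measurable_fun setT (Y i j).
  by apply: sub_measurable_fun mY; exact: other_events_measurable.
have := measurable_fun_eqr (measurable_funPT (XX a0)) mYT.
move=> /(_ measurableT [set true]); rewrite setTI.
rewrite (_ : _ @^-1` _ = [set w | XX a0 w = Y i j w]); first exact.
by apply/seteqP; split=> w /= /eqP.
Qed.

End Stalling.

(** * The expected error *)

Section ExpectedError.
Local Open Scope classical_set_scope.
Local Open Scope ereal_scope.
Variables (R : realType) (orth : orth_fun R) (refl : reflector_fun R).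
Hypotheses (orthP : orth_spec orth) (reflP : reflector_spec refl).
Variables (m n b : nat) (A : 'M[R]_(m, n)) (tau : R).
Hypotheses (b_gt0 : (0 < b)%N) (tau_gt0 : (0 < tau)%R).
Context d (T : measurableType d) (P : probability T R).
Variables (X : nat -> 'I_m -> 'I_b -> {RV P >-> R}) (s : nat -> T -> 'I_n).
Hypothesis X_iid : iid_std_normal
  (fun a : nat * 'I_m * 'I_b => X a.1.1 a.1.2 a.2).
Hypothesis s_sampled : pivots_sampled orth refl A tau X s.

Local Notation Pi t w := (range_proj A (gauss_mx X w) t).
Local Notation st t w := (loop_state orth A (gauss_mx X w) t).
Local Notation stops := (stops orth A tau X).
Local Notation starts := (starts s).
Local Notation err t w J := (frob2 (proj_residual A (Pi t w) J)).

(** By [pivot_law] with the indicator of a vanishing minor, the density is zero exactly where the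
    integrand lives. *)
Lemma singular_negligible t k J :
  P.-negligible [set w | [/\ stops t k w, starts J k w &
                             minor J (Pi t w) k = 0%R]].
Proof.
pose TD : measurableType _ := g_sigma_algebraType (draws X t).
pose B : set T := (fun w => minor J (Pi t w) k) @^-1` [set 0%R].
have mB : measurable (B : set TD).
  rewrite -[X in measurable X]setTI; apply: (measurable_minor A J k) => //.
have mBT : measurable B.
  exact: (sub_gen_measurable (@draws_measurable _ _ _ _ _ _ X t)).
have mS : measurable (stops t k `&` starts J k).
  apply: measurableI; first exact: measurable_stops.
  exact: (measurable_starts s_sampled).
apply: (@negligibleS _ _ _ _ (B `&` (stops t k `&` starts J k))).
  by move=> w [].
apply/negligibleP; first exact: measurableI.
transitivity (\int[P]_(w in stops t k `&` starts J k) (\1_B w)%:E).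
  by rewrite integral_indic.
have mI : measurable_fun (setT : set TD) (\1_B : TD -> R) by exact: measurable_indic.
rewrite (pivot_law orthP reflP s_sampled J (leqnn k) mI) //.
rewrite integral0_eq // => w _; rewrite indicE; case: (boolP (w \in B)).
  by rewrite inE => ->; rewrite mul0r mulr0.
by rewrite mul0r.
Qed.

Lemma arp_error_stops t k w (J : 'I_k -> 'I_n) :
  stops t k w -> (forall l : 'I_k, s l w = J l) ->
  minor (s^~ w) (Pi t w) k != 0%R ->
  arp_error orth A tau (gauss_mx X w) (s^~ w) = (err t w J)%:E.
Proof.
move=> [pw ck] sJ; rewrite /arp_error pw.
case: _ / ck J sJ => J sJ.
have [_ _ _ VPi _] := loop_state_inv orthP A (gauss_mx X w) t.
rewrite -VPi minor_full sqrf_eq0 => det0.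
have uV : rowsub (fun i : 'I_(st_cols (st t w)) => s i w) (st_V (st t w)) \in unitmx.
  by rewrite unitmxE unitfE.
rewrite uV /residual -proj_residualE // VPi.
by rewrite (_ : (fun i => _) = J) //; apply/funext => l.
Qed.

(** Extends a finite choice to a sequence; [s 0 point] supplies an element of ['I_n] although [n] is
    a variable. *)
Definition path_of k (J : {ffun 'I_k -> 'I_n}) (l : nat) : 'I_n :=
  if insub l is Some i then J i else s 0 point.

Lemma path_ofE k (J : {ffun 'I_k -> 'I_n}) (i : 'I_k) : path_of J i = J i.
Proof. by rewrite /path_of valK. Qed.

Lemma minor_path_of k (J : {ffun 'I_k -> 'I_n}) (G : 'M[R]_n) :
  minor (path_of J) G k = \det (mxsub J J G).
Proof.
by congr (\det _); apply/matrixP => a c; rewrite !mxE !path_ofE.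
Qed.

Lemma measurable_err t k (J : 'I_k -> 'I_n) :
  measurable_fun (setT : set (g_sigma_algebraType (draws X t)))
    (fun w : g_sigma_algebraType (draws X t) => err t w J).
Proof.
apply: measurable_frob2; apply: measurable_proj_residual.
exact: measurable_draws_range_proj.
Qed.

Lemma measurable_errT t k (J : 'I_k -> 'I_n) : measurable_fun setT (fun w => err t w J).
Proof.
by apply: (sub_measurable_fun (@draws_measurable _ _ _ _ _ _ X t)); exact: measurable_err.
Qed.

(** The factorials cancel and leave $(k+1)|A - A\Pi|^2$; the halting test bounds it by
    $(k+1)\tau/(tb+1)$, and $k \le tb$. *)
Lemma sum_minor_err t k w : stops t k w ->
  (\sum_(J : {ffun 'I_k -> 'I_n})
     err t w J * (minor (path_of J) (Pi t w) k / (k ^_ k)%:R) <= tau)%R.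
Proof.
move=> [/passes_Some[ht _] ck].
have [VV _ _ VPi] := loop_state_inv orthP A (gauss_mx X w) t.
rewrite st_k_loop_state; case: _ / ck => kt; move: ht; rewrite haltedE // => ht.
have := sum_det_proj_residual A VV; rewrite /= VPi.
move: (st_cols _) kt => {}k kt; set F := frob2 _ in ht * => le_sum.
have k0 : (0 < k`!%:R :> R)%R by rewrite ltr0n fact_gt0.
apply: (@le_trans _ _ (k.+1%:R * F)%R); last first.
  apply: le_trans (_ : k.+1%:R * (tau / (t * b).+1%:R) <= _)%R.
    by rewrite ler_wpM2l.
  rewrite mulrCA ler_piMr ?(ltW tau_gt0) //.
  by rewrite ler_pdivrMr ?ltr0n // mul1r ler_nat.
rewrite -(ler_pM2l k0) mulrA; apply: le_trans le_sum.
rewrite mulr_sumr le_eqVlt; apply/orP; left; apply/eqP; apply: eq_bigr => J _.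
rewrite minor_path_of ffactnn mulrCA [RHS]mulrC; congr (_ * _)%R.
by rewrite mulrC divfK // gt_eqF.
Qed.

Lemma sum_expected_err t k :
  \sum_(J : {ffun 'I_k -> 'I_n})
     \int[P]_(w in stops t k `&` starts (path_of J) k) (err t w J)%:E <=
  \int[P]_(w in stops t k) tau%:E.
Proof.
have mD : measurable (stops t k) by exact: measurable_stops.
pose f (J : {ffun 'I_k -> 'I_n}) w :=
  (err t w J * (minor (path_of J) (Pi t w) k / (k ^_ k)%:R))%R.
have mf J D : measurable_fun D (EFin \o f J).
  apply: measurable_funTS; apply/measurable_EFinP; apply: measurable_funM.
    exact: measurable_errT.
  apply: measurable_funM; last exact: measurable_cst.
  apply: (sub_measurable_fun (@draws_measurable _ _ _ _ _ _ X t)).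
  exact: measurable_minor.
have f0 J w : stops t k w -> 0 <= (f J w)%:E.
  move=> Dw; rewrite lee_fin mulr_ge0 ?frob2_ge0 // divr_ge0 //.
  exact: (minor_stops_ge0 orthP reflP _ Dw).
rewrite (eq_bigr (fun J => \int[P]_(w in stops t k) (f J w)%:E)); last first.
  move=> J _; rewrite (pivot_law orthP reflP s_sampled) //.
    exact: measurable_err.
  by move=> w; exact: frob2_ge0.
rewrite -ge0_integral_sum //; last by move=> J; exact: mf.
apply: ge0_le_integral => //.
- by move=> w Dw; apply: sume_ge0 => J _; exact: f0.
- by apply: emeasurable_sum => J; exact: mf.
- by move=> w Dw; rewrite sumEFin lee_fin; exact: sum_minor_err.
Qed.

(** A measurable substitute for the error. Indices up to [n] suffice: without stalls there are at
    most [n] passes, and [V] never has more than [n] columns. *)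
Definition total_err w : R :=
  \sum_(p : 'I_n.+1 * 'I_n.+1) \sum_(J : {ffun 'I_p.2 -> 'I_n})
    \1_(stops p.1 p.2 `&` starts (path_of J) p.2) w * err p.1 w J.

Lemma measurable_stops_starts t k J : measurable (stops t k `&` starts J k).
Proof.
apply: measurableI; first exact: measurable_stops.
exact: (measurable_starts s_sampled).
Qed.

Lemma stops_disjoint w t k t' k' :
  stops t k w -> stops t' k' w -> t = t' /\ k = k'.
Proof. by move=> [pw <-] [] ; rewrite pw => -[<-] <-. Qed.

(** Each event [stops t k] contributes at most $\tau$ times its probability, and these events are
    disjoint. *)
Lemma integral_total_err : \int[P]_w (total_err w)%:E <= tau%:E.
Proof.
have mI (p : 'I_n.+1 * 'I_n.+1) : measurable (stops p.1 p.2).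
  exact: measurable_stops.
have mtau p : measurable_fun setT
    (fun w => (\1_(stops (p : 'I_n.+1 * 'I_n.+1).1 p.2) w * tau)%:E).
  apply/measurable_EFinP; apply: measurable_funM; last exact: measurable_cst.
  exact: measurable_indic.
have mfJ (p : 'I_n.+1 * 'I_n.+1) (J : {ffun 'I_p.2 -> 'I_n}) :
    measurable_fun setT (fun w =>
      (\1_(stops p.1 p.2 `&` starts (path_of J) p.2) w * err p.1 w J)%:E).
  apply/measurable_EFinP; apply: measurable_funM; last exact: measurable_errT.
  by apply: measurable_indic; exact: measurable_stops_starts.
have fJ0 (p : 'I_n.+1 * 'I_n.+1) (J : {ffun 'I_p.2 -> 'I_n}) w :
    0 <= (\1_(stops p.1 p.2 `&` starts (path_of J) p.2) w * err p.1 w J)%:E.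
  by rewrite lee_fin mulr_ge0 ?frob2_ge0.
have msum (p : 'I_n.+1 * 'I_n.+1) : measurable_fun setT (fun w =>
    \sum_(J : {ffun 'I_p.2 -> 'I_n})
      (\1_(stops p.1 p.2 `&` starts (path_of J) p.2) w * err p.1 w J)%:E).
  by apply: emeasurable_sum => J; exact: mfJ.
under eq_integral => w _.
  rewrite /total_err -sumEFin; under eq_bigr do rewrite -sumEFin.
  over.
rewrite ge0_integral_sum //; last by move=> p w _; apply: sume_ge0.
apply: (@le_trans _ _ (\sum_(p : 'I_n.+1 * 'I_n.+1)
   \int[P]_w (\1_(stops p.1 p.2) w * tau)%:E)).
  apply: lee_sum => p _; rewrite ge0_integral_sum //.
  apply: le_trans (le_trans (sum_expected_err p.1 p.2) _).
    apply: lee_sum => J _; rewrite [leRHS]integral_mkcond le_eqVlt.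
    apply/orP; left; apply/eqP; apply: eq_integral => w _.
    by rewrite patchE indicE; case: (w \in _); rewrite ?mul1r ?mul0r.
  rewrite integral_mkcond le_eqVlt; apply/orP; left; apply/eqP.
  apply: eq_integral => w _.
  by rewrite patchE indicE; case: (w \in _); rewrite ?mul1r ?mul0r.
rewrite -ge0_integral_sum //; last first.
  by move=> p w _; rewrite lee_fin mulr_ge0 // ltW.
apply: (@le_trans _ _ (\int[P]_w tau%:E)); last first.
  by rewrite integral_cst // [X in _ * X](probability_setT P) mule1.
apply: ge0_le_integral => //.
- by move=> w _; apply: sume_ge0 => p _; rewrite lee_fin mulr_ge0 // ltW.
- exact: emeasurable_sum.
move=> w _; rewrite sumEFin lee_fin -mulr_suml ler_piMl ?(ltW tau_gt0) //.
have [[p pw]|nop] := pselect (exists p : 'I_n.+1 * 'I_n.+1, stops p.1 p.2 w).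
  rewrite (bigD1 p) //= big1 ?addr0 ?indicE ?mem_set // => q qp.
  rewrite indicE memNset // => qw; case/negP: qp; apply/eqP.
  have [E1 E2] := stops_disjoint qw pw.
  by rewrite [q]surjective_pairing [p]surjective_pairing;
    congr pair; exact: val_inj.
rewrite big1 // => q _; rewrite indicE memNset // => qw.
by apply: nop; exists q.
Qed.

Definition singular p w := exists J : {ffun 'I_(p : 'I_n.+1 * 'I_n.+1).2 -> 'I_n},
  [/\ stops p.1 p.2 w, starts (path_of J) p.2 w &
      minor (path_of J) (Pi p.1 w) p.2 = 0%R].

Lemma arp_error_le w :
  (forall t, ~ stalls A (gauss_mx X w) t) -> (forall p, ~ singular p w) ->
  arp_error orth A tau (gauss_mx X w) (s^~ w) <= (total_err w)%:E.
Proof.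
move=> nostall nosing.
have [t tn pw] := passes_terminates orthP tau_gt0 nostall.
have kn : (st_cols (st t w) < n.+1)%N.
  by rewrite ltnS (loop_inv_cols (loop_state_inv orthP A _ t)).
pose p : 'I_n.+1 * 'I_n.+1 := (@Ordinal n.+1 t tn, Ordinal kn).
pose J : {ffun 'I_p.2 -> 'I_n} := [ffun l : 'I_p.2 => s l w].
have Dw : stops p.1 p.2 w by [].
have sJ l : (l < p.2)%N -> s l w = path_of J l.
  by move=> lp; rewrite (path_ofE J (Ordinal lp)) ffunE.
have mJ : minor (path_of J) (Pi p.1 w) p.2 != 0%R.
  by apply/eqP => mJ; apply: (nosing p); exists J; split.
rewrite (@arp_error_stops p.1 p.2 w J) //; first last.
- by rewrite (minor_ext sJ).
- by move=> l; rewrite ffunE.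
rewrite lee_fin /total_err (bigD1 p) //= (bigD1 J) //=.
rewrite indicE mem_set // mul1r -addrA lerDl addr_ge0 //.
  by apply: sumr_ge0 => J' _; rewrite mulr_ge0 ?frob2_ge0.
by do 2![apply: sumr_ge0 => ? _]; rewrite mulr_ge0 ?frob2_ge0.
Qed.

Lemma total_err_ge0 w : (0 <= total_err w)%R.
Proof. by do 2![apply: sumr_ge0 => ? _]; rewrite mulr_ge0 ?frob2_ge0. Qed.

Lemma measurable_total_err : measurable_fun setT total_err.
Proof.
apply: measurable_sum => p; apply: measurable_sum => J.
apply: measurable_funM; last exact: measurable_errT.
by apply: measurable_indic; exact: measurable_stops_starts.
Qed.

(** Off a measurable null set [N] covering stalls and singular pivot choices, [total_err] bounds the
    error. On [N] the bound is infinite, at no cost to its integral. *)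
Lemma expected_arp_error :
  \int[P]_w arp_error orth A tau (gauss_mx X w) (s^~ w) <= tau%:E.
Proof.
have [N [mN N0 subN]] : P.-negligible
    ((\bigcup_t [set w | stalls A (gauss_mx X w) t]) `|`
     [set w | exists p, singular p w]).
  apply: negligibleU.
    by apply: negligible_bigcup => t; exact: stalls_negligible.
  apply: negligible_fin_bigcup => p; apply: negligible_fin_bigcup => J.
  exact: singular_negligible.
apply: (@le_trans _ _ (\int[P]_w ((total_err w)%:E + +oo * (\1_N w)%:E))).
  apply: le_lower_integral => w.
    rewrite /arp_error; case: passes => // t; case: ifP => // _.
    by rewrite lee_fin frob2_ge0.
  rewrite indicE; case: (boolP (w \in N)) => [_|].
    by rewrite mule1 addey // leey.
  rewrite notin_setE => Nw; rewrite mule0 adde0; apply: arp_error_le.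
    by move=> t stall; apply: Nw; apply: subN; left; exists t.
  by move=> p sing; apply: Nw; apply: subN; right; exists p.
have mN1 : measurable_fun setT (fun w => (\1_N w : R)%:E).
  by apply/measurable_EFinP; exact: measurable_indic.
have mtot : measurable_fun setT (EFin \o total_err).
  by apply/measurable_EFinP; exact: measurable_total_err.
have mNy : measurable_fun setT (fun w => +oo * (\1_N w : R)%:E).
  exact: measurable_funeM.
have Ny0 w : 0 <= +oo * (\1_N w : R)%:E by rewrite mule_ge0.
rewrite ge0_integralD //; last by move=> w _; rewrite lee_fin total_err_ge0.
rewrite ge0_integralZl // integral_indic // setIT [X in +oo * X]N0 mule0 adde0.
exact: integral_total_err.
Qed.

End ExpectedError.

Theorem theorem4p1 (R : realType)
  (orth : orth_fun R) (orthP : orth_spec orth)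
  (refl : reflector_fun R) (reflP : reflector_spec refl)
  (m n b : nat) (b_gt0 : (0 < b)%N)
  (A : 'M[R]_(m, n)) (tau : R) (tau_gt0 : 0 < tau)
  (d : measure_display) (T : measurableType d) (P : probability T R)
  (X : nat -> 'I_m -> 'I_b -> {RV P >-> R})
  (X_iid : iid_std_normal
     (fun a : nat * 'I_m * 'I_b => X a.1.1 a.1.2 a.2))
  (s : nat -> T -> 'I_n)
  (s_sampled : pivots_sampled orth refl A tau X s) :
  (\int[P]_w arp_error orth A tau (gauss_mx X w) (fun i => s i w)
     <= tau%:E)%E.
Proof.
exact: (expected_arp_error orthP reflP b_gt0 tau_gt0 X_iid s_sampled).
Qed.
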